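(* For $n\in\mathbb{Z}^+$, let $Q_t(n)$ be the number in system of an infinite server queue with batch arrivals where the batch size is drawn from the i.i.d. sequence $\{N_i(n)\mid i\in\mathbb{Z}^+\}$. Let $\lambda>0$ be the arrival rate and let $\mu>0$ be the rate of exponentially distributed service. Suppose that for any $i$ and $n$ there is a sequence of i.i.d. non-negative, discrete random variables $\{B_k\mid k\in\mathbb{Z}^+\}$ such that $N_i(n)=\sum_{k=1}^n B_k$. Then the limiting moment generating function of the batch scaled queue is $$\lim_{n\to\infty}\mathbb{E}\left[e^{\frac{\theta}{n}Q_t(n)}\right]=\begin{cases} \exp\left(\frac{\lambda}{\mu}\left(\mathrm{Ei}(\theta\mathbb{E}[B_1])-\mathrm{Ei}(\theta\mathbb{E}[B_1]e^{-\mu t})-\mu t\right)\right) & \text{if }\theta>0, \\ \exp\left(\frac{\lambda}{\mu}\left(E_1(-\theta\mathbb{E}[B_1]e^{-\mu t})-E_1(-\theta\mathbb{E}[B_1])-\mu t\right)\right) & \text{if }\theta<0, \\ 1 & \text{if }\theta=0, \end{cases}$$ for all $t\ge0$.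
   Context: Model: for each $n$, batches arrive at the epochs of a Poisson process of rate $\lambda$, the $i$-th batch bringing $N_i(n)$ customers simultaneously. There are infinitely many servers, so each customer starts service immediately and leaves after an independent exponentially distributed service time of rate $\mu$; the batch sizes are independent of the queue. $Q_t(n)$ is the number of customers present at time $t$, and the initial number in system $Q_0$ does not scale with $n$. For $x>0$, the exponential integral functions are $\mathrm{Ei}(x)=-\int_{-x}^\infty\frac{e^{-s}}{s}\,\mathrm{d}s$ (real valued, as a Cauchy principal value) and $E_1(x)=\int_x^\infty\frac{e^{-s}}{s}\,\mathrm{d}s$.
   Formalization: Assumes 0 < E[B_1] < ∞, so that Ei and E_1 are defined, and, for θ > 0, that B_1 and the initial number Q_0 each have a finite exponential moment of some positive order; otherwise the expectation on the left is +∞ for every n (for t > 0). *)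

(* Defs.v *)
From HB Require Import structures.
From mathcomp Require Import all_boot all_order all_algebra.
From mathcomp Require Import all_classical all_reals all_analysis.

Set Implicit Arguments.
Unset Strict Implicit.
Unset Printing Implicit Defensive.

Import Order.TTheory GRing.Theory Num.Theory.
Import numFieldNormedType.Exports.

Local Open Scope classical_set_scope.
Local Open Scope ring_scope.

Section exponential_integrals.
Context {R : realType}.
Notation mu := lebesgue_measure.

Definition expint1 (x : R) : R :=
  \int[mu]_(s in `[x, +oo[) (expR (- s) / s).

(* For x > 0 the singularity s = 0 is interior to the range of integration:
   Cauchy principal value. *)
Definition expintEi (x : R) : R :=
  - lim ((fun e : R => \int[mu]_(s in `]- x, - e[) (expR (- s) / s) +
                       \int[mu]_(s in `]e, +oo[) (expR (- s) / s)) @ 0^'+).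

End exponential_integrals.

Section independence.
Context d (T : measurableType d) (R : realType) (P : probability T R).

Definition mutually_independent (I : Type) (X : I -> T -> R) : Prop :=
  forall (m : nat) (i : 'I_m -> I) (A : 'I_m -> set R),
    injective i -> (forall k, measurable (A k)) ->
    P [set w | forall k, A k (X (i k) w)] =
    (\prod_(k < m) P (X (i k) @^-1` A k))%E.

Definition same_law d' (T' : measurableType d') (X Y : {RV P >-> T'}) : Prop :=
  forall A : set T', measurable A -> distribution P X A = distribution P Y A.

Definition exponential_law (rate : R) (X : {RV P >-> R}) : Prop :=
  forall A : set R, measurable A ->
    distribution P X A = exponential_prob rate A.

End independence.

Inductive queue_input : Type :=
| InInitial
| InResidual of nat
| InGap of nat
| InBatch of nat
| InService of nat & nat.

(* Indices start at 0: [gap 0] is the time from 0 to the first arrival epoch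
   of the Poisson process, [gap i.+1] the time between the epochs of batches i
   and i.+1. By the memoryless property the customers present at time 0 have
   Exp(mu) residual service times. *)
Record batch_queue d (T : measurableType d) (R : realType)
    (P : probability T R) (lambda mu : R) := BatchQueue {
  initial  : {RV P >-> nat} ;
  residual : nat -> {RV P >-> R} ;
  gap      : nat -> {RV P >-> R} ;
  batch    : nat -> {RV P >-> nat} ;
  service  : nat -> nat -> {RV P >-> R} ;
  residual_law : forall j, exponential_law mu (residual j) ;
  gap_law      : forall i, exponential_law lambda (gap i) ;
  batch_law    : forall i j, same_law (batch i) (batch j) ;
  service_law  : forall i k, exponential_law mu (service i k) ;
  inputs_independent : mutually_independent P (fun s : queue_input =>
    match s with
    | InInitial => fun w => (initial w)%:R
    | InResidual j => fun w => residual j w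
    | InGap i => fun w => gap i w
    | InBatch i => fun w => (batch i w)%:R
    | InService i k => fun w => service i k w
    end)
}.

Section number_in_system.
Context d (T : measurableType d) (R : realType) (P : probability T R).
Context (lambda mu : R) (q : batch_queue P lambda mu).

Definition epoch (i : nat) (w : T) : R := \sum_(j < i.+1) gap q j w.

Definition initial_present (t : R) (w : T) : nat :=
  (\sum_(j < initial q w) (t < residual q j w)%R)%N.

Definition batch_present (i : nat) (t : R) (w : T) : nat :=
  (\sum_(k < batch q i w) (t < epoch i w + service q i k w)%R)%N.

(* The series has finitely many terms almost surely; on the null event where
   it diverges, [fine] gives it the value 0. *)
Definition number_in_system (t : R) (w : T) : R :=
  (initial_present t w)%:R +
  fine (\sum_(0 <= i <oo | (epoch i w <= t)%R) (batch_present i t w)%:R%:E)%E.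

End number_in_system.

(* Main.v *)
Require Import Defs.
From HB Require Import structures.
From mathcomp Require Import all_boot all_order all_algebra.
From mathcomp Require Import all_classical all_reals all_analysis.
From mathcomp Require Import measurable_realfun.
From mathcomp Require Import ring lra.

(** Customers that arrive in batches and never interact form a compound Poisson
    sum. Conditionally on the epochs A_i of the batches, a batch of size N that
    arrived u units of time ago still contains a binomially thinned number of
    its customers, since each of them survives with probability exp(-mu u). So
    it contributes the factor

      g(u) = E (1 + (exp(alpha) - 1) exp(-mu u)) ^ N

    to the moment generating function at alpha, and by the usual formula for
    marked Poisson processes the batches arrived before t contribute

      exp (lambda int_0^t (g(u) - 1) du).

    With alpha = theta / n and N a sum of n independent copies of B, g is the
    n-th power of the moment generating function of B at
    b_n = ln (1 + (exp(theta / n) - 1) exp(-mu u)). As n b_n tends to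
    theta exp(-mu u), this power tends to exp (theta E[B] exp(-mu u)), and
    dominated convergence moves the limit inside the integral over u. The
    substitution s = theta E[B] exp(-mu u) turns the limit integral into a
    difference of exponential integrals. The customers present at time 0 are
    independent of the rest and their factor tends to 1, because theta / n
    times their number vanishes.

    Two points need work. The first is the formula for marked Poisson
    processes, when the process is given by its independent exponential gaps.
    Here it is proved by splitting on the number k of arrivals before t. The
    [weight] of k is exp (alpha * number of batch customers at t) on the event
    that exactly k batches have arrived, and 0 off that event. Peeling off the
    first gap and the first batch gives a convolution recursion for its
    expectation ([weight_expectation_rec]). Its solution is
    exp (-lambda t) (lambda G t)^k / k! with G an antiderivative of g
    ([weight_expectation]), and the sum over k is the exponential wanted
    ([batch_customers_mgf]). All the terms are nonnegative, so both signs of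
    alpha are treated at once, and alpha = 0 gives total mass 1, whence almost
    surely some epoch lies beyond t ([arrivals_diverge]).

    The second is to integrate the independent inputs one block at a time.
    Blocks are compared through the sigma-algebras that they generate on the
    sample space itself, so that conditioning on a block is an application of
    Tonelli's theorem ([indep_integral]).

    The principal value in Ei is handled by the decompositions
    exp(x)/x = 1/x + (exp(x) - 1)/x and exp(-x)/x = 1/x + (exp(-x) - 1)/x,
    whose last terms extend continuously to 0: the logarithms coming from the
    two sides of the singularity cancel ([expint_antiderivatives]). *)

Set Implicit Arguments.
Unset Strict Implicit.
Unset Printing Implicit Defensive.
Import Order.TTheory GRing.Theory Num.Theory.
Import numFieldNormedType.Exports.

Local Open Scope classical_set_scope.
Local Open Scope ring_scope.

(** * Integration over independent blocks of inputs *)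

Section independence_fubini.
Context d (T : measurableType d) (R : realType) (P : probability T R).
Context (I : eqType) (X : I -> T -> R).
Hypothesis mX : forall i, measurable_fun [set: T] (X i).
Hypothesis indX : mutually_independent P X.

Definition cylinder (s : seq I) (A : I -> set R) : set T :=
  [set w | forall i, i \in s -> A i (X i w)].

(** The finite-dimensional events of the block [J]: a pi-system, on which
    mutual independence can be read off directly. *)
Definition cylinders (J : set I) : set (set T) :=
  [set C | exists s A, [/\ uniq s, forall i, i \in s -> J i,
     forall i, measurable (A i) & C = cylinder s A]].

(** The sample space with the coarser sigma-algebra generated by the block [J].
    Measurability over [sigma_on J] says that only inputs of [J] are used, and
    no space of values for infinitely many inputs has to be built. *)
Definition sigma_on (J : set I) : measurableType (cylinders J).-sigma :=
  g_sigma_algebraType (cylinders J).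

Lemma cylinder_prob s A : uniq s -> (forall i, measurable (A i)) ->
  P (cylinder s A) = (\prod_(i <- s) P (X i @^-1` A i))%E.
Proof.
move=> us mA.
have := indX (i := tnth (in_tuple s)) (A := fun k => A (tnth (in_tuple s) k)).
move=> /(_ _ (fun k => mA _)) H.
rewrite (big_tnth _ _ s) -H; last exact/tuple_uniqP.
congr (P _); apply/seteqP; split=> w /= h.
- by move=> k; apply: h; exact: mem_tnth.
- by move=> i /seq_tnthP[k ->]; exact: h.
Qed.

Lemma measurable_cylinder s A : (forall i, measurable (A i)) ->
  measurable (cylinder s A).
Proof.
move=> mA; elim: s => [|i s ih].
  by rewrite (_ : cylinder _ _ = setT)//; apply/seteqP; split.
rewrite (_ : cylinder _ _ = X i @^-1` A i `&` cylinder s A).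
  by apply: measurableI => //; rewrite -[_ @^-1` _]setTI; exact: mX.
apply/seteqP; split=> w /=.
- by move=> h; split; [apply: h; rewrite mem_head|move=> j js; apply: h; rewrite inE js orbT].
- by move=> [h1 h2] j; rewrite inE => /predU1P[->//|]; exact: h2.
Qed.

Lemma cylindersT J : cylinders J setT.
Proof. by exists [::], (fun=> setT); split => //; apply/seteqP; split. Qed.

Lemma cylindersI J : setI_closed (cylinders J).
Proof.
move=> _ _ [s [A [us sJ mA ->]]] [s' [A' [us' sJ' mA' ->]]].
pose r (s : seq I) (A : I -> set R) i := if i \in s then A i else setT.
exists (undup (s ++ s')), (fun i => r s A i `&` r s' A' i); split.
- exact: undup_uniq.
- by move=> i; rewrite mem_undup mem_cat => /orP[/sJ|/sJ'].
- by move=> i; apply: measurableI; rewrite /r; case: ifP.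
- apply/seteqP; split => w /=.
  + by move=> [h h'] i _; rewrite /r; split; case: ifPn => //; [exact: h|exact: h'].
  + move=> h; split=> i is_; have := h i; rewrite mem_undup mem_cat is_ ?orbT /r => /(_ isT)[];
    by rewrite is_.
Qed.

Lemma measurable_sigma_on J : measurable_fun [set: T] (id : T -> sigma_on J).
Proof.
apply: (@measurability _ _ T (sigma_on J) setT id (cylinders J)) => // _ [_ [s [A [us sJ mA ->]]] <-].
by rewrite setTI; exact: measurable_cylinder.
Qed.

Lemma measurable_input J i : J i ->
  measurable_fun [set: sigma_on J] (X i : sigma_on J -> R).
Proof.
move=> Ji _ A mA; rewrite setTI; apply: sub_sigma_algebra.
exists [:: i], (fun=> A); split => //.
  by move=> j; rewrite inE => /eqP ->.
apply/seteqP; split=> w /=.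
- by move=> h j; rewrite inE => /eqP ->.
- by apply; rewrite mem_head.
Qed.

Section two_blocks.
Variables (J1 J2 : set I).
Hypothesis J12 : J1 `&` J2 = set0.

Let T1 := sigma_on J1.
Let T2 := sigma_on J2.
Let id1_mixin := isMeasurableFun.Build _ _ T T1 id (@measurable_sigma_on J1).
Let id1 : {mfun T >-> T1} := HB.pack (id : T -> T1) id1_mixin.
Let P1 := distribution P id1.
Let id2_mixin := isMeasurableFun.Build _ _ T T2 id (@measurable_sigma_on J2).
Let id2 : {mfun T >-> T2} := HB.pack (id : T -> T2) id2_mixin.
Let P2 := distribution P id2.

Let diag (w : T) : T1 * T2 := (w, w).

Let mdiag : measurable_fun [set: T] diag.
Proof.
by apply/measurable_fun_pairP; split; exact: measurable_sigma_on.
Qed.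

Let diag_mixin := isMeasurableFun.Build _ _ T (T1 * T2)%type diag mdiag.
Let mdiagf : {mfun T >-> (T1 * T2)%type} := HB.pack diag diag_mixin.

Lemma cylinder_indep (A : set T1) (B : set T2) :
  cylinders J1 A -> cylinders J2 B -> P (A `&` B) = (P A * P B)%E.
Proof.
move=> [s [A1 [us sJ mA ->]]] [s' [A' [us' sJ' mA' ->]]].
have dis i : i \in s -> i \notin s'.
  move=> /sJ j1; apply/negP => /sJ' j2.
  by have : (J1 `&` J2) i by []; rewrite J12.
pose A2 i := if i \in s then A1 i else A' i.
rewrite (_ : cylinder s _ `&` _ = cylinder (s ++ s') A2); last first.
  apply/seteqP; split => w /=.
  - move=> [h h'] i; rewrite mem_cat /A2.
    by case: ifPn => [/h//|_ /h'].
  - move=> h; split => i is_; have := h i; rewrite mem_cat is_ ?orbT /A2 => /(_ isT).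
      by rewrite is_.
    by case: ifPn => // /dis; rewrite is_.
rewrite !cylinder_prob//; last 2 first.
- rewrite cat_uniq us us' andbT; apply/hasPn => i is'; apply/negP => /dis.
  by rewrite is'.
- by move=> i; rewrite /A2; case: ifP.
rewrite big_cat; congr (_ * _)%E; apply: eq_big_seq => i is_.
  by rewrite /A2 is_.
by rewrite /A2; case: ifPn => // /dis; rewrite is_.
Qed.

Let rectangles : set (set (T1 * T2)) :=
  [set A `*` B | A in cylinders J1 & B in cylinders J2].

Let measurable_rectangles : @measurable _ (T1 * T2)%type = <<s rectangles >>.
Proof.
rewrite eqEsubset; split; last first.
  apply: smallest_sub; first exact: smallest_sigma_algebra.
  by move=> _ [A cA [B cB <-]]; apply: measurableX; exact: sub_sigma_algebra.
move=> A mA.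
pose U : measurableType _ := g_sigma_algebraType rectangles.
suff : measurable_fun [set: U] (id : U -> T1 * T2).
  by move=> /(_ measurableT _ mA); rewrite setTI.
apply/measurable_fun_pairP; split.
- apply: (@measurability _ _ U T1 setT fst (cylinders J1)) => // _ [B cB <-].
  rewrite setTI; apply: sub_sigma_algebra; exists B => //.
  exists setT; first exact: cylindersT.
  by apply/seteqP; split => -[x y] //= [].
- apply: (@measurability _ _ U T2 setT snd (cylinders J2)) => // _ [B cB <-].
  rewrite setTI; apply: sub_sigma_algebra; exists setT; first exact: cylindersT.
  by exists B => //; apply/seteqP; split => -[x y] //= [].
Qed.

(** Two disjoint blocks may be sampled separately. Both sides are integrals over
    the product of the two generated sigma-algebras: on the left against the
    image of [P] by the diagonal, on the right against a product measure. These
    two measures agree on rectangles of cylinders, which is independence, hence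
    everywhere. *)
Lemma indep_integral (f : T1 * T2 -> \bar R) :
  measurable_fun [set: T1 * T2] f -> (forall z, 0 <= f z)%E ->
  (\int[P]_w f (w, w) = \int[P]_w1 \int[P]_w2 f (w1, w2))%E.
Proof.
move=> mf f0.
have -> : (\int[P]_w f (w, w) = \int[distribution P mdiagf]_z f z)%E.
  by rewrite ge0_integral_distribution.
have E : forall A : set (T1 * T2), measurable A ->
    (distribution P mdiagf) A = (P1 \x P2)%E A.
  move=> A mA.
  apply: (measure_unique rectangles (fun=> setT)) => //.
  - move=> _ _ [A1 cA1 [A2 cA2 <-]] [B1 cB1 [B2 cB2 <-]].
    rewrite -setXI; exists (A1 `&` B1); first exact: cylindersI.
    by exists (A2 `&` B2) => //; exact: cylindersI.
  - move=> _; exists setT; first exact: cylindersT.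
    by exists setT; [exact: cylindersT|rewrite setXTT].
  - by rewrite bigcup_const.
  - move=> _ [A1 cA1 [A2 cA2 <-]].
    transitivity (P1 A1 * P2 A2)%E; first by rewrite -cylinder_indep.
    by rewrite -product_measure1E//; exact: sub_sigma_algebra.
  - by move=> _; rewrite (le_lt_trans (probability_le1 _ _))// ltry.
rewrite (eq_measure_integral (P1 \x P2)%E); last by move=> A mA _; exact: E.
rewrite fubini_tonelli1//.
rewrite ge0_integral_distribution//; last 2 first.
- exact: measurable_fun_fubini_tonelli_F.
- by move=> y; exact: integral_ge0.
apply: eq_integral => w _ /=; rewrite /fubini_F.
rewrite ge0_integral_distribution//.
by apply: measurableT_comp => //; exact: measurable_pair1.
Qed.

End two_blocks.
End independence_fubini.

Section product_rule.
Context d (T : measurableType d) (R : realType) (P : probability T R).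
Context (I : eqType) (X : I -> T -> R).
Hypothesis mX : forall i, measurable_fun [set: T] (X i).
Hypothesis indX : mutually_independent P X.
Local Open Scope ereal_scope.

Lemma measurable_of_sigma_on J d' (U : measurableType d') (f : T -> U) :
  measurable_fun [set: sigma_on X J] (f : sigma_on X J -> U) ->
  measurable_fun [set: T] f.
Proof.
move=> mf; exact: (measurableT_comp mf (measurable_sigma_on mX (J := J))).
Qed.

Lemma indep_integralM (J1 J2 : set I) (f g : T -> \bar R) :
  J1 `&` J2 = set0 ->
  measurable_fun [set: sigma_on X J1] (f : sigma_on X J1 -> \bar R) ->
  measurable_fun [set: sigma_on X J2] (g : sigma_on X J2 -> \bar R) ->
  (forall w, 0 <= f w) -> (forall w, 0 <= g w) ->
  \int[P]_w (f w * g w) = \int[P]_w f w * \int[P]_w g w.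
Proof.
move=> J12 mf mg f0 g0.
have mgT := measurable_of_sigma_on mg; have mfT := measurable_of_sigma_on mf.
pose F (z : sigma_on X J1 * sigma_on X J2) := f z.1 * g z.2.
have := indep_integral mX indX J12 (f := F) => /(_ _ _)/= ->; last 2 first.
- apply: emeasurable_funM.
  + exact: (measurableT_comp mf).
  + exact: (measurableT_comp mg).
- by move=> z; exact: mule_ge0.
rewrite /F/= -ge0_integralZr//; last exact: integral_ge0.
by apply: eq_integral => w _; rewrite ge0_integralZl.
Qed.

(** Induction on the sequence: its head is a block disjoint from its tail. *)
Lemma indep_integral_prod (s : seq I) (h : I -> R -> R) : uniq s ->
  (forall i, measurable_fun [set: R] (h i)) -> (forall i x, 0 <= h i x)%R ->
  \int[P]_w (\prod_(i <- s) h i (X i w))%:E =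
  \prod_(i <- s) \int[P]_w (h i (X i w))%:E.
Proof.
move=> us mh h0; elim: s us => [_|i s ih /= /andP[is_ us]].
  under eq_integral do rewrite big_nil.
  by rewrite big_nil integral_cst//= probability_setT mule1.
under eq_integral do rewrite big_cons EFinM.
rewrite big_cons -ih// (@indep_integralM [set i] [set j | j \in s])//.
- by apply/seteqP; split => // j [/= ->]; rewrite (negPf is_).
- apply/measurable_EFinP; apply: measurableT_comp => //.
  exact: measurable_input.
- apply/measurable_EFinP.
  apply: measurable_prod => j js; apply: measurableT_comp => //.
  exact: measurable_input.
- by move=> w; rewrite lee_fin.
- by move=> w; rewrite lee_fin prodr_ge0.
Qed.

End product_rule.

(** * Paths of the inputs and the weight of k arrivals *)

Section path_functionals.
Context {R : realType}.

(** The argument [n] is real and is truncated, so that a batch size and a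
    service time can be entries of one and the same real-valued path. *)
Definition count_above (n : R) (v : nat -> R) (u : R) : nat :=
  (\sum_(k < Num.truncn n) (u < v k)%R)%N.

Definition survivors (x : queue_input -> R) (u : R) : nat :=
  count_above (x (InBatch 0)) (fun k => x (InService 0 k)) u.

(** The path seen after the first batch: gaps, batches and services are
    renumbered. The customers present at time 0 are left in place, which keeps
    the map injective and the shifted inputs independent. *)
Definition shift (s : queue_input) : queue_input :=
  match s with
  | InInitial => InInitial
  | InResidual j => InResidual j
  | InGap i => InGap i.+1
  | InBatch i => InBatch i.+1
  | InService i k => InService i.+1 k
  end.

(** The moment generating factor of the batch customers at time [t] on the event
    of exactly [k] arrivals in [0, t]. It is defined by recursion on the first
    gap, after which the shifted path faces the horizon [t - g]. *)
Fixpoint weight (alpha : R) (k : nat) (t : R) (x : queue_input -> R) : R :=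
  let g := x (InGap 0) in
  if k is k'.+1 then
    (0 <= g <= t)%R%:R * expR (alpha * (survivors x (t - g))%:R) *
    weight alpha k' (t - g) (x \o shift)
  else (t < g)%R%:R.

Lemma weight_ge0 alpha k t x : 0 <= weight alpha k t x.
Proof. by elim: k t x => //= k ih t x; rewrite !mulr_ge0 ?expR_ge0. Qed.

End path_functionals.

Section path_measurability.
Context d (Z : measurableType d) (R : realType).

Lemma measurable_ltr_set (f g : Z -> R) :
  measurable_fun [set: Z] f -> measurable_fun [set: Z] g ->
  measurable [set z | f z < g z].
Proof.
move=> mf mg; have := measurable_fun_ltr mf mg measurableT.
by move=> /(_ [set true] I); rewrite setTI.
Qed.

(** Measurability of a sum whose number of terms is itself random. *)
Lemma measurable_select d' (U : measurableType d') (m : Z -> nat) (F : nat -> Z -> U) :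
  (forall n, measurable [set z | m z = n]) ->
  (forall n, measurable_fun [set: Z] (F n)) ->
  measurable_fun [set: Z] (fun z => F (m z) z).
Proof.
move=> mm mF _ A mA; rewrite setTI.
rewrite (_ : _ @^-1` A = \bigcup_n ([set z | m z = n] `&` F n @^-1` A)).
  apply: bigcup_measurable => n _; apply: measurableI => //.
  by rewrite -[_ @^-1` _]setTI; exact: mF.
apply/seteqP; split => z /=; first by exists (m z).
by move=> [n _ [/= ->]].
Qed.

Lemma measurable_truncn_eq (f : Z -> R) n : measurable_fun [set: Z] f ->
  measurable [set z | Num.truncn (f z) = n].
Proof.
move=> mf.
have mle m : measurable [set z | (Num.truncn (f z) <= m)%N].
  rewrite (_ : [set _ | _] = [set z | f z < m.+1%:R]).
    exact: measurable_ltr_set.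
  by apply/seteqP; split => z /=; rewrite truncn_le_nat.
case: n => [|n].
  rewrite (_ : [set _ | _] = [set z | (Num.truncn (f z) <= 0)%N])//.
  by apply/seteqP; split => z /=; rewrite leqn0 => /eqP.
rewrite (_ : [set _ | _] = [set z | (Num.truncn (f z) <= n.+1)%N] `\` [set z | (Num.truncn (f z) <= n)%N]).
  exact: measurableD.
apply/seteqP; split => z /=; first by move=> ->; split => //; rewrite ltnn.
by move=> [h /negP]; rewrite -ltnNge => h'; apply/eqP; rewrite eqn_leq h.
Qed.

Lemma measurable_indicator (b : Z -> bool) : measurable_fun [set: Z] b ->
  measurable_fun [set: Z] (fun z => (b z)%:R : R).
Proof.
move=> mb; have h : measurable_fun [set: bool] (fun c : bool => c%:R : R) by [].
exact: (measurableT_comp h mb).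
Qed.

Lemma measurable_count_above (n u : Z -> R) (v : nat -> Z -> R) :
  measurable_fun [set: Z] n -> measurable_fun [set: Z] u ->
  (forall k, measurable_fun [set: Z] (v k)) ->
  measurable_fun [set: Z] (fun z => (count_above (n z) (v^~ z) (u z))%:R : R).
Proof.
move=> mn mu mv; rewrite /count_above.
apply: (@measurable_select _ _ (fun z => Num.truncn (n z))
  (fun m z => (\sum_(k < m) (u z < v k z)%R)%N%:R : R)).
  by move=> m; exact: measurable_truncn_eq.
move=> m; under eq_fun do rewrite natr_sum.
by apply: measurable_sum => k; apply/measurable_indicator/measurable_fun_ltr.
Qed.

Lemma measurable_survivors (y : Z -> queue_input -> R) (u : Z -> R) :
  measurable_fun [set: Z] (y^~ (InBatch 0)) ->
  (forall k, measurable_fun [set: Z] (y^~ (InService 0 k))) ->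
  measurable_fun [set: Z] u ->
  measurable_fun [set: Z] (fun z => (survivors (y z) (u z))%:R : R).
Proof.
by move=> mn mv mu; apply: (@measurable_count_above _ u (fun k => y^~ (InService 0 k))).
Qed.

Lemma measurable_weight alpha k (y : Z -> queue_input -> R) (u : Z -> R) :
  (forall i, measurable_fun [set: Z] (y^~ (InGap i))) ->
  (forall i, measurable_fun [set: Z] (y^~ (InBatch i))) ->
  (forall i k, measurable_fun [set: Z] (y^~ (InService i k))) ->
  measurable_fun [set: Z] u ->
  measurable_fun [set: Z] (fun z => weight alpha k (u z) (y z)).
Proof.
elim: k y u => [|k ih] y u mg mb ms mu /=.
  exact/measurable_indicator/measurable_fun_ltr.
have mug : measurable_fun [set: Z] (fun z => u z - y z (InGap 0)) by exact: measurable_funB.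
apply: measurable_funM; first apply: measurable_funM.
- apply/measurable_indicator/measurable_and; exact: measurable_fun_ler.
- apply: measurableT_comp => //; apply: measurable_funM => //.
  exact: measurable_survivors.
- exact: (ih (fun z => y z \o shift) _ (fun i => mg i.+1) (fun i => mb i.+1)
    (fun i => ms i.+1)).
Qed.

End path_measurability.

(** * Integration against an exponential variable *)

Section density.
Context d (T : measurableType d) (R : realType).
Context (m mu : {measure set T -> \bar R}) (p : T -> R).
Hypothesis mp : measurable_fun [set: T] p.
Hypothesis p0 : forall x, 0 <= p x.
Hypothesis m_density : forall A, measurable A -> m A = (\int[mu]_(x in A) (p x)%:E)%E.
Local Open Scope ereal_scope.
Import HBNNSimple.

Let mpE D : measurable_fun D (EFin \o p).
Proof. by apply: measurable_funTS; exact/measurable_EFinP. Qed.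

Let density_nnsfun (f : {nnsfun T >-> R}) :
  \int[m]_x (f x)%:E = \int[mu]_x ((f x)%:E * (p x)%:E).
Proof.
under [LHS]eq_integral do rewrite fimfunE -fsumEFin//.
rewrite [LHS]ge0_integral_fsum//; last 2 first.
  - by move=> r; exact/measurable_EFinP/measurableT_comp.
  - by move=> n x _; rewrite EFinM nnfun_muleindic_ge0.
under [RHS]eq_integral.
  move=> x xD; rewrite fimfunE -fsumEFin// muleC ge0_mule_fsumr; last first.
    by move=> r; rewrite EFinM nnfun_muleindic_ge0.
  over.
rewrite [RHS]ge0_integral_fsum//; last 2 first.
  - move=> r; apply: emeasurable_funM => //.
    by apply/measurable_EFinP; apply/measurableT_comp.
  - by move=> n x _; rewrite mule_ge0 ?lee_fin// -lee_fin EFinM nnfun_muleindic_ge0.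
apply: eq_fsbigr => r _.
have mr : measurable (f @^-1` [set r]) by [].
rewrite integralZl_indic_nnsfun//= integral_indic//= setIT m_density//.
have [r0|r0] := leP 0%R r; last first.
  rewrite preimage_nnfun0//= integral_set0 mule0 integral0_eq//.
  by move=> x _; rewrite indicE in_set0 mulr0 mule0.
rewrite -ge0_integralZl//; last by move=> x _; rewrite lee_fin.
rewrite [LHS]integral_mkcond; apply: eq_integral => x _ /=.
by rewrite patchE indicE; case: ifP => _; rewrite ?mulr1 ?mulr0 ?mule0// muleC.
Qed.

(** From indicators, where it is the hypothesis, to simple functions and then to
    monotone limits. *)
Lemma ge0_integral_density (f : T -> \bar R) :
  measurable_fun [set: T] f -> (forall x, 0 <= f x) ->
  \int[m]_x f x = \int[mu]_x (f x * (p x)%:E).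
Proof.
move=> mf f0.
pose f_ := nnsfun_approx measurableT mf.
transitivity (limn (fun n => \int[m]_x (f_ n x)%:E)).
  rewrite -monotone_convergence//=.
  - apply: eq_integral => ? /[!inE] xD; apply/esym/cvg_lim => //=.
    exact: cvg_nnsfun_approx.
  - by move=> n; exact/measurable_EFinP/measurable_funTS.
  - by move=> n ? _; rewrite lee_fin.
  - by move=> ? _ ? ? mn; rewrite lee_fin; exact/lefP/nd_nnsfun_approx.
transitivity (limn (fun n => \int[mu]_x ((f_ n x)%:E * (p x)%:E))).
  by apply: congr_lim; apply/funext => n; exact: density_nnsfun.
rewrite -monotone_convergence//=.
- apply: eq_integral => x _; apply/cvg_lim => //=.
  by apply: cvgeMr => //; exact: cvg_nnsfun_approx.
- move=> n; apply: emeasurable_funM => //.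
  exact/measurable_EFinP/measurable_funTS.
- by move=> n ? _; rewrite mule_ge0 ?lee_fin.
- move=> x _ ? ? mn; apply: lee_wpmul2r; first by rewrite lee_fin.
  by rewrite lee_fin; exact/lefP/nd_nnsfun_approx.
Qed.

End density.

Section exponential_variable.
Context d (T : measurableType d) (R : realType) (P : probability T R).
Context (rate : R) (X : T -> R).
Hypothesis rate0 : 0 < rate.
Hypothesis mX : measurable_fun [set: T] X.
Hypothesis lawX : forall A, measurable A -> P (X @^-1` A) = exponential_prob rate A.
Local Open Scope ereal_scope.
Notation leb := (@lebesgue_measure R).

Let X_mixin := isMeasurableFun.Build _ _ T (measurableTypeR R) X mX.
Let Xm : {mfun T >-> measurableTypeR R} := HB.pack X X_mixin.

Lemma exponential_integral (f : R -> \bar R) :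
  measurable_fun [set: R] f -> (forall x, 0 <= f x) ->
  \int[P]_w f (X w) = \int[leb]_x (f x * (exponential_pdf rate x)%:E).
Proof.
move=> mf f0.
have -> : \int[P]_w f (X w) = \int[distribution P Xm]_x f x.
  by rewrite ge0_integral_distribution.
apply: (@ge0_integral_density _ (measurableTypeR R) R (distribution P Xm) leb (exponential_pdf rate)) => //.
- exact: measurable_exponential_pdf.
- by move=> x; rewrite exponential_pdf_ge0// ltW.
Qed.

(** The maximum makes the formula valid on the whole line. *)
Lemma exponential_tail u :
  P [set w | (u < X w)%R] = (expR (- rate * Num.max u 0))%:E.
Proof.
have mS B : measurable B -> measurable (X @^-1` B).
  by move=> mB; rewrite -[_ @^-1` _]setTI; exact: mX.
rewrite (_ : [set _ | _] = ~` (X @^-1` `]-oo, u])); last first.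
  by apply/seteqP; split => w /=; rewrite in_itv/= ltNge => /negP.
rewrite probability_setC; last exact: mS.
rewrite lawX// /exponential_prob.
have mpdf (D : set R) : measurable_fun D (EFin \o exponential_pdf rate).
  by apply: measurable_funTS; apply/measurable_EFinP; exact: measurable_exponential_pdf.
have low v : (v <= 0)%R -> \int[leb]_(x in `]-oo, v[) (exponential_pdf rate x)%:E = 0.
  move=> v0; apply: integral0_eq => x /=; rewrite in_itv/= => xv.
  by rewrite lt0_exponential_pdf// (lt_le_trans xv).
have [u0|u0] := leP u 0%R.
  rewrite -integral_itv_bndo_bndc//; first by rewrite low// mulr0 expR0 sube0.
have -> : `]-oo, u]%classic = `]-oo, 0%R[%classic `|` `[0%R, u]%classic.
  by rewrite -itv_bndbnd_setU// bnd_simp ltW.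
rewrite ge0_integral_setU//=.
- have := exponential_prob_itv0c rate u0; rewrite /exponential_prob => ->.
  rewrite low// add0e -!EFinB; congr EFin.
  by rewrite opprB addrC subrK.
- exact: mpdf.
- by move=> x _; rewrite lee_fin exponential_pdf_ge0// ltW.
- apply/disj_setPRL => x /=; rewrite !in_itv/= => /andP[x0 _].
  by apply/negP; rewrite -leNgt.
Qed.

End exponential_variable.

(** * Customers of one batch *)

HB.instance Definition _ := gen_eqMixin queue_input.

Section batch_inputs.
Context d (T : measurableType d) (R : realType) (P : probability T R).
Context (lambda mu : R) (lambda0 : 0 < lambda) (mu0 : 0 < mu).
Local Open Scope ereal_scope.

(** What the computation needs to know of the inputs. It is stable under
    [shift], so inductions can be carried out over all such families; of the
    batch sizes only the common moment generating function [M] matters. *)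
Record batch_inputs (M : R -> \bar R) (X : queue_input -> T -> R) : Prop := {
  inputs_measurable : forall s, measurable_fun [set: T] (X s) ;
  inputs_indep : mutually_independent P X ;
  gap_exponential : forall i A, measurable A ->
    P (X (InGap i) @^-1` A) = exponential_prob lambda A ;
  service_exponential : forall i k A, measurable A ->
    P (X (InService i k) @^-1` A) = exponential_prob mu A ;
  batch_nat : forall i w,
    X (InBatch i) w = (Num.truncn (X (InBatch i) w))%:R ;
  batch_mgf : forall i b, \int[P]_w (expR (b * X (InBatch i) w))%:E = M b
}.

Lemma shift_inj : injective shift.
Proof. by move=> [|j|i|i|i k] [|j'|i'|i'|i' k'] //= [] -> // ->. Qed.

Lemma batch_inputs_shift M X : batch_inputs M X -> batch_inputs M (X \o shift).
Proof.
move=> [mX iX gX sX nX bX]; split.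
- by move=> s; exact: mX.
- by move=> m i A inji; apply: (iX m (shift \o i)); exact: inj_comp shift_inj _.
- by move=> i; exact: gX.
- by move=> i; exact: sX.
- by move=> i; exact: nX.
- by move=> i; exact: bX.
Qed.

(** The generating function E exp(alpha 1_(S > u)) of one customer with an
    exponential service time S. *)
Definition thinned (alpha u : R) : R :=
  (1 + (expR alpha - 1) * expR (- mu * Num.max u 0))%R.

Lemma survival_itv (u : R) : (0 < expR (- mu * Num.max u 0) <= 1)%R.
Proof.
rewrite expR_gt0 -expR0 ler_expR mulNr oppr_le0 mulr_ge0//; first exact: ltW.
by rewrite le_max lexx orbT.
Qed.

Lemma thinned_gt0 alpha u : (0 < thinned alpha u)%R.
Proof.
have /andP[p0 p1] := survival_itv u; rewrite /thinned.
set p := expR (_ * _) in p0 p1 *.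
have := expR_gt0 alpha; nra.
Qed.

Lemma service_mgf M X (HX : batch_inputs M X) i k alpha u :
  \int[P]_w (expR (alpha * (u < X (InService i k) w)%R%:R))%:E = (thinned alpha u)%:E.
Proof.
have mX := inputs_measurable HX (InService i k).
have tail := exponential_tail mu0 mX (@service_exponential _ _ HX i k) u.
have mS : measurable [set w | (u < X (InService i k) w)%R].
  exact: measurable_ltr_set.
rewrite (eq_integral (fun w => 1 + (expR alpha - 1)%:E * (\1_[set w | (u < X (InService i k) w)%R] w)%:E)); last first.
  move=> w _; rewrite indicE -EFinM -EFinD.
  have -> : (w \in [set w | (u < X (InService i k) w)%R]) = (u < X (InService i k) w)%R.
    by apply/idP/idP; rewrite inE.
  by case: (u < _)%R; rewrite ?mulr1 ?mulr0 ?expR0 ?addr0// addrCA subrr addr0.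
rewrite integralD//=; last 2 first.
- by apply: finite_measure_integrable_cst.
- apply: integrableZl => //; exact: integrable_indic.
rewrite integral_cst//= probability_setT mule1 integralZl//; last first.
  exact: integrable_indic.
rewrite (_ : \int[P]_x _ = (expR (- mu * Num.max u 0))%:E) //.
by rewrite integral_indic// setIT; exact: tail.
Qed.

(** Thinning: the batch size and the service times are disjoint blocks. For a
    fixed size m the services give [thinned alpha u] to the power m, which is
    the integrand of the moment generating function of the size at the
    logarithm of [thinned alpha u]. *)
Lemma survivors_mgf M X (HX : batch_inputs M X) alpha u :
  \int[P]_w (expR (alpha * (survivors (X^~ w) u)%:R))%:E = M (ln (thinned alpha u)).
Proof.
have mX := inputs_measurable HX; have iX := inputs_indep HX.
pose J1 := [set InBatch 0]; pose J2 := [set InService 0 k | k in [set: nat]].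
have J12 : J1 `&` J2 = set0.
  by apply/seteqP; split => // s [/= ->] [].
pose F (z : sigma_on X J1 * sigma_on X J2) : \bar R :=
  (expR (alpha * (count_above (X (InBatch 0) z.1) (fun k => X (InService 0 k) z.2) u)%:R))%:E.
have := indep_integral mX iX J12 (f := F); rewrite /F/= => ->; last 2 first.
- apply/measurable_EFinP; apply: measurableT_comp => //; apply: measurable_funM => //.
  apply: (@measurable_count_above _ (sigma_on X J1 * sigma_on X J2)%type R
    (fun z => X (InBatch 0) z.1) (fun=> u) (fun k z => X (InService 0 k) z.2)) => //.
  + exact: (measurableT_comp (measurable_input (J := J1) _)).
  + move=> k; apply: (measurableT_comp (measurable_input (J := J2) _)) => //.
    by exists k.
- by move=> z; rewrite lee_fin expR_ge0.
rewrite -(batch_mgf HX 0); apply: eq_integral => w1 _.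
rewrite /count_above [in RHS](batch_nat HX).
set m := Num.truncn _.
rewrite expRM_natr lnK; last exact: thinned_gt0.
transitivity (\int[P]_w (\prod_(s <- [seq InService 0 k | k <- index_iota 0 m])
    expR (alpha * (u < X s w)%R%:R))%:E).
  apply: eq_integral => w _; rewrite big_map -expR_sum; congr (expR _)%:E.
  by rewrite -mulr_sumr big_mkord natr_sum.
rewrite (indep_integral_prod mX iX (h := fun _ x => expR (alpha * (u < x)%R%:R))).
- rewrite big_map (eq_bigr (fun=> (thinned alpha u)%:E)); last first.
    by move=> k _; exact: service_mgf HX _ _ _ _.
  by rewrite prodEFin big_const_seq count_predT size_iota subn0 iter_mulr_1.
- by rewrite map_inj_uniq ?iota_uniq// => ? ? [].
- move=> _; apply: measurableT_comp => //; apply: measurable_funM => //.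
  by apply/measurable_indicator; exact: measurable_fun_ltr.
- by move=> _ x; exact: expR_ge0.
Qed.

End batch_inputs.

(** * Antiderivatives *)

Section calculus.
Context {R : realType}.
Notation leb := (@lebesgue_measure R).
Implicit Types (f F g G : R -> R) (a b x : R).

Lemma integral_derivative f F a b : a <= b ->
  (forall x, a <= x <= b -> is_derive x 1 F (f x)) ->
  (forall x, a <= x <= b -> {for x, continuous f}) ->
  (\int[leb]_(x in `[a, b]) (f x)%:E)%E = (F b - F a)%:E.
Proof.
rewrite le_eqVlt => /predU1P[<- _ _|ab dF cf].
  by rewrite set_itv1 integral_set1 subrr.
have cF x : a <= x <= b -> {for x, continuous F}.
  move=> /dF dFx; apply: differentiable_continuous; apply/derivable1_diffP.
  by have [] := dFx.
rewrite EFinB; apply: continuous_FTC2 => //.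
- apply: continuous_in_subspaceT => x /[!inE]/=; rewrite in_itv/=; exact: cf.
- split.
  + move=> x; rewrite in_itv/= => /andP[ax xb]; have [] := dF x => //.
    by rewrite !ltW.
  + by apply: cvg_at_right_filter; apply: cF; rewrite lexx ltW.
  + by apply: cvg_at_left_filter; apply: cF; rewrite lexx ltW.
- move=> x; rewrite in_itv/= => /andP[ax xb].
  have ? := dF x; rewrite derive1E; apply: derive_val.
  by apply: dF; rewrite !ltW.
Qed.

Lemma continuous_itv_integrable f a b :
  (forall x, a <= x <= b -> {for x, continuous f}) ->
  leb.-integrable `[a, b] (EFin \o f).
Proof.
move=> cf; apply: continuous_compact_integrable; first exact: segment_compact.
by apply: continuous_in_subspaceT => x /[!inE]/=; rewrite in_itv/=; exact: cf.
Qed.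

(** The half-line starts at -1 so that 0 is an interior point: derivatives at
    the left end of [0, t] are then two-sided. *)
Lemma antiderivative g : continuous g -> exists2 G, G 0 = 0 &
  forall x : R, -1 < x -> is_derive x 1 G (g x).
Proof.
move=> cg; pose G0 x := \int[leb]_(s in `[-1, x]) g s.
exists (fun x => G0 x - G0 0); first by rewrite subrr.
move=> x x1.
have [dG vG] : derivable G0 x 1 /\ G0^`()%classic x = g x.
  apply: (@continuous_FTC1_closed _ g (-1) x (x + 1)) => //; first by rewrite ltrDl.
    by apply: continuous_itv_integrable => y _; exact: cg.
  exact: cg.
have h : is_derive x 1 G0 (g x) by exact: (DeriveDef dG (etrans (esym (derive1E _ _)) vG)).
by apply: is_derive_eq; rewrite subr0.
Qed.

End calculus.

(** * Expectation of the weights *)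

Section weight_expectation.
Context d (T : measurableType d) (R : realType) (P : probability T R).
Context (lambda mu : R) (lambda0 : 0 < lambda) (mu0 : 0 < mu).
Context (M : R -> \bar R) (alpha : R).
Local Open Scope ereal_scope.
Notation leb := (@lebesgue_measure R).

(** The first gap is independent of all the rest; given its value, the first
    batch and the shifted path are two disjoint blocks. *)
Lemma weight_expectation_rec X (HX : batch_inputs P lambda mu M X) k t :
  \int[P]_w (weight alpha k.+1 t (X^~ w))%:E =
  \int[P]_w ((0 <= X (InGap 0) w <= t)%R%:R%:E *
    (M (ln (thinned mu alpha (t - X (InGap 0) w))) *
     \int[P]_w' (weight alpha k (t - X (InGap 0) w) ((X \o shift)^~ w'))%:E)).
Proof.
have mX := inputs_measurable HX; have iX := inputs_indep HX.
pose J1 := [set InGap 0]; pose J2 := [set s | s <> InGap 0].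
have J12 : J1 `&` J2 = set0 by apply/seteqP; split => // s [].
pose Z := (sigma_on X J1 * sigma_on X J2)%type.
pose F (z : Z) : \bar R := ((0 <= X (InGap 0) z.1 <= t)%R%:R *
  expR (alpha * (survivors (X^~ z.2) (t - X (InGap 0) z.1))%:R) *
  weight alpha k (t - X (InGap 0) z.1) ((X \o shift)^~ z.2))%:E.
have mg : measurable_fun [set: Z] (fun z : Z => X (InGap 0) z.1).
  exact: (measurableT_comp (measurable_input (J := J1) _)).
have mtg : measurable_fun [set: Z] (fun z : Z => t - X (InGap 0) z.1)%R.
  exact: measurable_funB.
have mo s : s <> InGap 0 -> measurable_fun [set: Z] (fun z : Z => X s z.2).
  by move=> s0; apply: (measurableT_comp (measurable_input (J := J2) _)).
have := indep_integral mX iX J12 (f := F); rewrite /F/= => ->; last 2 first.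
- apply/measurable_EFinP; apply: measurable_funM; first apply: measurable_funM.
  + by apply/measurable_indicator/measurable_and; exact: measurable_fun_ler.
  + apply: measurableT_comp => //; apply: measurable_funM => //.
    apply: (@measurable_survivors _ Z R (fun z s => X s z.2)) => //.
      exact: mo.
    by move=> j; exact: mo.
  + apply: (@measurable_weight _ Z R alpha k (fun z s => X (shift s) z.2)) => //.
    * by move=> i; exact: mo.
    * by move=> i; exact: mo.
    * by move=> i j; exact: mo.
- by move=> z; rewrite lee_fin !mulr_ge0 ?expR_ge0 ?weight_ge0.
apply: eq_integral => w1 _; set s := (t - _)%R.
have mshift i : measurable_fun [set: T] (X (shift i)) by exact: mX.
have ms : measurable_fun [set: T] (fun w => expR (alpha * (survivors (X^~ w) s)%:R)).
  apply: measurableT_comp => //; apply: measurable_funM => //.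
  exact: (@measurable_survivors _ T R (fun w => X^~ w)).
have mw : measurable_fun [set: T] (fun w => weight alpha k s ((X \o shift)^~ w)).
  apply: (@measurable_weight _ T R alpha k (fun w => (X \o shift)^~ w) (fun=> s)) => // *; exact: mshift.
under eq_integral do rewrite -mulrA EFinM.
rewrite ge0_integralZl//; last 2 first.
- by apply/measurable_EFinP; exact: measurable_funM.
- by move=> w _; rewrite lee_fin mulr_ge0 ?expR_ge0 ?weight_ge0.
congr (_ * _); under eq_integral do rewrite EFinM.
pose K1 := [set r | r = InBatch 0 \/ exists j, r = InService 0 j].
pose K2 := range shift.
rewrite (@indep_integralM _ _ _ _ _ X mX iX K1 K2).
- by rewrite (survivors_mgf mu0 HX).
- by apply/seteqP; split => // r [[->|[j ->]]] [[]].
- apply/measurable_EFinP; apply: measurableT_comp => //; apply: measurable_funM => //.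
  apply: (@measurable_survivors _ (sigma_on X K1) R (fun z r => X r z)) => //.
    by apply: measurable_input; left.
  by move=> j; apply: measurable_input; right; exists j.
- apply/measurable_EFinP.
  have mi i : measurable_fun [set: sigma_on X K2] (X (shift i) : sigma_on X K2 -> R).
    by apply: measurable_input; exists i.
  by apply: (@measurable_weight _ (sigma_on X K2) R alpha k (fun z r => X (shift r) z)).
- by move=> w; rewrite lee_fin expR_ge0.
- by move=> w; rewrite lee_fin weight_ge0.
Qed.

Context (g G : R -> R).
Hypothesis gE : forall u, M (ln (thinned mu alpha u)) = (g u)%:E.
Hypothesis cg : continuous g.
Hypothesis dG : forall x : R, (-1 < x)%R -> is_derive x 1%R G (g x).
Hypothesis G0 : G 0%R = 0%R.

Let cG (x : R) : (-1 < x)%R -> {for x, continuous G}.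
Proof.
move=> /dG dGx; apply: differentiable_continuous; apply/derivable1_diffP.
by have [] := dGx.
Qed.

Let csub (t : R) : continuous (fun y : R => t - y)%R.
Proof. by move=> y; apply: continuousB => //; exact: cvg_cst. Qed.

(* G(t - x)^k.+1 / k.+1 has derivative - g(t - x) G(t - x)^k in x. *)
Let integral_power k t : (0 <= t)%R ->
  \int[leb]_(x in `[0%R, t]) (g (t - x) * G (t - x) ^+ k)%:E =
  (G t ^+ k.+1 / k.+1%:R)%:E.
Proof.
move=> t0; pose F := (- k.+1%:R^-1 \*: (G \o (fun y => t - y)) ^+ k.+1)%R.
have dF (x : R) : (0 <= x <= t)%R ->
    is_derive x 1%R F (g (t - x) * G (t - x) ^+ k)%R.
  move=> /andP[x0 xt]; have tx : (-1 < t - x)%R by lra.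
  have dGx := dG tx.
  have d1 : is_derive x 1%R (fun y : R => t - y)%R (-1)%R.
    by have := is_deriveB (is_derive_cst t x 1%R) (is_derive_id x 1%R); rewrite sub0r.
  have d2 := @is_derive1_comp _ G (fun y => t - y)%R x _ _ dGx d1.
  have d3 := is_deriveX k.+1 d2.
  apply: (is_derive_eq (is_deriveZ (- k.+1%:R^-1)%R d3)).
  rewrite /= /GRing.scale/=.
  have : (k.+1%:R : R) != 0%R by rewrite pnatr_eq0.
  by move: (k.+1%:R : R) => c c0; field.
rewrite (integral_derivative t0 dF) => [|x /andP[x0 xt]].
  rewrite /F !fctE/= subrr G0 expr0n subr0 /= /GRing.scale/= mulr0 sub0r.
  by rewrite mulNr opprK mulrC.
have tx : (-1 < t - x)%R by lra.
have c1 : {for x, continuous (fun y : R => g (t - y))%R}.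
  by apply: continuous_comp; [exact: csub|exact: cg].
have c2 : {for x, continuous (fun y : R => G (t - y))%R}.
  by apply: continuous_comp; [exact: csub|exact: cG].
have c3 : {for x, continuous (fun y : R => G (t - y) ^+ k)%R}.
  exact: (continuous_comp c2 (@exprn_continuous R k _)).
exact: (continuousM c1 c3).
Qed.

(** In the recursion the exponentials combine to the constant exp(-lambda t),
    and what remains is the integral of g(t - x) G(t - x)^k over [0, t]. *)
Lemma weight_expectation X (HX : batch_inputs P lambda mu M X) k t : (0 <= t)%R ->
  \int[P]_w (weight alpha k t (X^~ w))%:E =
  (expR (- lambda * t) * ((lambda * G t) ^+ k / k`!%:R))%:E.
Proof.
elim: k X HX t => [|k ih] X HX t t0.
  have mX := inputs_measurable HX (InGap 0).
  have mS : measurable [set w | (t < X (InGap 0) w)%R].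
    exact: measurable_ltr_set.
  have := exponential_tail lambda0 mX (@gap_exponential _ _ _ _ _ _ _ _ HX 0) t.
  rewrite max_l// fact0 expr0 divr1 mulr1 => <-.
  rewrite -[in RHS](setIT [set w | _]) -integral_indic//.
  apply: eq_integral => w _ /=; rewrite indicE.
  by rewrite (_ : (w \in _) = (t < X (InGap 0) w)%R)//; apply/idP/idP; rewrite inE.
rewrite weight_expectation_rec//.
pose p x := (g (t - x) * G (t - x) ^+ k)%R.
pose c := (expR (- lambda * t) * (lambda ^+ k / k`!%:R))%R.
pose h x := ((0 <= x <= t)%R%:R * (g (t - x) *
   (expR (- lambda * (t - x)) * ((lambda * G (t - x)) ^+ k / k`!%:R))))%R.
have cp x : (0 <= x <= t)%R -> {for x, continuous p}.
  move=> /andP[x0 xt].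
  have c1 : {for x, continuous (fun y : R => g (t - y))%R}.
    by apply: continuous_comp; [exact: csub|exact: cg].
  have c2 : {for x, continuous (fun y : R => G (t - y))%R}.
    by apply: continuous_comp; [exact: csub|apply: cG; lra].
  have c3 : {for x, continuous (fun y : R => G (t - y) ^+ k)%R}.
    exact: (continuous_comp c2 (@exprn_continuous R k _)).
  exact: (continuousM c1 c3).
have g0 u : (0 <= g u)%R.
  rewrite -lee_fin -gE -(batch_mgf HX 0).
  by apply: integral_ge0 => w _; rewrite lee_fin expR_ge0.
(* Off [0, t] both sides vanish; this form shows that h is measurable. *)
have hE x : (h x = c * (expR (lambda * x) * (p \_ `[0%R, t]) x))%R.
  rewrite /h patchE mem_setE; have [xt|] := boolP (x \in `[0%R, t]).
    move: xt; rewrite in_itv/= => /andP[x0 xt].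
    rewrite /c /p x0 xt mul1r exprMn.
    have -> : (expR (- lambda * (t - x)) = expR (- lambda * t) * expR (lambda * x))%R.
      by rewrite -expRD; congr expR; ring.
    by ring.
  by rewrite in_itv/= => /negPf ->; rewrite !mul0r !mulr0.
have hpE x : (h x * exponential_pdf lambda x = lambda * c * (p \_ `[0%R, t]) x)%R.
  rewrite hE patchE mem_setE; have [xt|] := boolP (x \in `[0%R, t]).
    move: xt; rewrite in_itv/= => /andP[x0 xt].
    rewrite exponential_pdfE// mulNr expRN.
    have := expR_gt0 (lambda * x); move: (expR (lambda * x)) => e e0.
    by field; rewrite gt_eqF.
  by rewrite !mulr0 mul0r.
transitivity (\int[P]_w (h (X (InGap 0) w))%:E).
  apply: eq_integral => w _; rewrite /h gE.
  have [/andP[g0' gt]|_] := boolP (0 <= X (InGap 0) w <= t)%R; last by rewrite !mul0r mul0e.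
  by rewrite !mul1r mul1e ih ?subr_ge0//; exact: batch_inputs_shift.
have ip : leb.-integrable `[0%R, t] (EFin \o p).
  by apply: continuous_itv_integrable.
have mp : measurable_fun [set: R] (p \_ `[0%R, t]).
  apply/(measurable_restrictT _ _).1 => //; apply/measurable_EFinP.
  exact: (measurable_int leb).
have mh : measurable_fun [set: R] h.
  rewrite (_ : h = fun x => c * (expR (lambda * x) * (p \_ `[0%R, t]) x))%R; last exact/funext.
  apply: measurable_funM => //; apply: measurable_funM => //.
  by apply: measurableT_comp => //; exact: measurable_funM.
have h0 x : (0 <= h x)%R.
  rewrite /h; have [/andP[x0 xt]|_] := boolP (0 <= x <= t)%R; last by rewrite mul0r.
  rewrite mul1r mulr_ge0// -lee_fin -(ih X HX); last by rewrite subr_ge0.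
  by apply: integral_ge0 => w _; rewrite lee_fin weight_ge0.
rewrite (exponential_integral lambda0 (inputs_measurable HX (InGap 0))
   (@gap_exponential _ _ _ _ _ _ _ _ HX 0) (f := EFin \o h))//; last first.
  exact/measurable_EFinP.
transitivity (\int[leb]_x ((lambda * c)%:E * ((EFin \o p) \_ `[0%R, t]) x)).
  by apply: eq_integral => x _; rewrite /= -EFinM hpE EFinM !patchE; case: ifP.
rewrite integralZl//; last by apply/(integrable_mkcond _ _).1.
rewrite -integral_mkcond integral_power// -EFinM /c; congr EFin.
rewrite factS natrM exprMn !exprS.
have := fact_gt0 k; rewrite -(ltr0n R); move: (k`!%:R : R) => a a0.
have := ltr0Sn R k; move: (k.+1%:R : R) => b b0.
by field; rewrite !gt_eqF.
Qed.

End weight_expectation.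

(** * Weights and customers, path by path *)

Section pathwise.
Context {R : realType}.
Implicit Types (x : queue_input -> R) (t alpha : R) (i k : nat).

Definition arrival x i : R := \sum_(j < i.+1) x (InGap j).

Definition in_service x t i : nat :=
  count_above (x (InBatch i)) (fun k => x (InService i k)) (t - arrival x i).

Definition batch_customers x t : \bar R :=
  (\sum_(0 <= i <oo | (arrival x i <= t)%R) (in_service x t i)%:R%:E)%E.

Lemma arrival_shift x i : arrival (x \o shift) i = arrival x i.+1 - x (InGap 0).
Proof. by rewrite /arrival [in RHS]big_ord_recl/= addrAC subrr add0r. Qed.

Lemma in_service_shift x t i :
  in_service (x \o shift) (t - x (InGap 0)) i = in_service x t i.+1.
Proof.
rewrite /in_service arrival_shift; congr count_above.
by rewrite opprB addrA subrK.
Qed.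

Lemma arrival_mono x : (forall j, 0 <= x (InGap j)) ->
  {homo arrival x : i k / (i <= k)%N >-> i <= k}.
Proof.
move=> x0; apply: homo_leq => [//|? ? ?|i]; first exact: le_trans.
by rewrite /arrival [in leRHS]big_ord_recr/= lerDl.
Qed.

(** On the event of exactly [k] arrivals the indicators in [weight] are all 1. *)
Lemma weight_path alpha k x t : (forall j, 0 <= x (InGap j)) ->
  (forall i, (i < k)%N -> arrival x i <= t) -> t < arrival x k ->
  weight alpha k t x = expR (alpha * (\sum_(i < k) in_service x t i)%N%:R).
Proof.
elim: k x t => [|k ih] x t x0 le_t lt_t.
  by rewrite /= big_ord0 mulr0 expR0; move: lt_t; rewrite /arrival big_ord1 => ->.
have g_t : x (InGap 0) <= t by have := le_t 0 isT; rewrite /arrival big_ord1.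
rewrite /= g_t x0 mul1r ih; first last.
- by rewrite arrival_shift ltrD2r.
- by move=> i ik; rewrite arrival_shift lerD2r le_t.
- by move=> j; exact: x0.
rewrite -expRD -mulrDr -natrD big_ord_recl; congr (expR (alpha * _%:R)).
congr (_ + _)%N; first by rewrite /in_service /arrival big_ord1.
by apply: eq_bigr => i _; exact: in_service_shift.
Qed.

Lemma weight_neq0 alpha k x t : (forall j, 0 <= x (InGap j)) ->
  weight alpha k t x != 0 ->
  (forall i, (i < k)%N -> arrival x i <= t) /\ t < arrival x k.
Proof.
elim: k x t => [|k ih] x t x0 /=.
  by rewrite /arrival big_ord1; case: ltP => // _; rewrite eqxx.
have [/andP[_ g_t]|_] := boolP (_ <= _ <= _); last by rewrite !mul0r eqxx.
rewrite mul1r mulf_eq0 expR_eq0/= => /ih[j|]; first exact: x0.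
move=> le_t lt_t; split; last by move: lt_t; rewrite arrival_shift ltrD2r.
case=> [_|i ik]; first by rewrite /arrival big_ord1.
by have := le_t i ik; rewrite arrival_shift lerD2r.
Qed.

Lemma nneseries_single (f : nat -> \bar R) k :
  (forall i, 0 <= f i)%E -> (forall i, i != k -> f i = 0%E) ->
  (\sum_(0 <= i <oo) f i = f k)%E.
Proof.
move=> f0 fk; rewrite (nneseries_split 0 k.+1)// eseries0 ?adde0; last first.
  by move=> i ki _; rewrite fk// gtn_eqF.
rewrite add0n big_nat_recr//= big_nat_cond big1 ?add0e// => i /andP[/andP[_ ik] _].
by rewrite fk// ltn_eqF.
Qed.

Lemma batch_customers_finite k x t : (forall j, 0 <= x (InGap j)) ->
  (forall i, (i < k)%N -> arrival x i <= t) -> t < arrival x k ->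
  batch_customers x t = (\sum_(i < k) in_service x t i)%N%:R%:E.
Proof.
move=> x0 le_t lt_t; rewrite /batch_customers.
rewrite (nneseries_split_cond 0 k)// eseries0 ?adde0; last first.
  move=> i ki; rewrite leNgt (lt_le_trans lt_t)//.
  exact: arrival_mono.
rewrite add0n sumEFin big_mkord natr_sum; congr EFin.
by rewrite [in RHS](eq_bigl (fun i : 'I_k => arrival x i <= t))// => i; rewrite le_t.
Qed.

(** When gaps are nonnegative and some epoch lies beyond [t], exactly one [k]
    counts the arrivals before [t]; the series reduces to that term, and the
    series of the batch customers to its first [k] terms. *)
Lemma weight_decomposition alpha x t : (forall j, 0 <= x (InGap j)) ->
  (exists k, t < arrival x k) ->
  (\sum_(0 <= k <oo) (weight alpha k t x)%:E =
   (expR (alpha * fine (batch_customers x t)))%:E)%E.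
Proof.
move=> x0 [k0 tk0]; have ex : exists k, t < arrival x k by exists k0.
case: (ex_minnP ex) => k tk kmin.
have le_t i : (i < k)%N -> arrival x i <= t.
  by move=> ik; rewrite leNgt; apply/negP => /kmin; rewrite leqNgt ik.
rewrite (nneseries_single (k := k)).
- by rewrite (weight_path _ x0 le_t tk) (batch_customers_finite x0 le_t tk).
- by move=> i; rewrite lee_fin weight_ge0.
- move=> i ik; apply/eqP; rewrite eqe; apply/negPn/negP.
  move=> /(weight_neq0 x0)[le_i lt_i]; move: ik; rewrite neq_ltn => /orP[ik|ki].
  + by have := kmin i lt_i; rewrite leqNgt ik.
  + by have := le_i k ki; rewrite leNgt tk.
Qed.

Lemma weight_sum0 alpha x t : (forall j, 0 <= x (InGap j)) ->
  ~ (exists k, t < arrival x k) ->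
  (\sum_(0 <= k <oo) (weight alpha k t x)%:E = 0)%E.
Proof.
move=> x0 nk; apply: eseries0 => k _ _; apply/eqP; rewrite eqe; apply/negPn/negP.
by move=> /(weight_neq0 x0)[_ tk]; apply: nk; exists k.
Qed.

End pathwise.

Section measurable_customers.
Context d (Z : measurableType d) (R : realType) (y : Z -> queue_input -> R).
Hypothesis mg : forall i, measurable_fun [set: Z] (y^~ (InGap i)).
Hypothesis mb : forall i, measurable_fun [set: Z] (y^~ (InBatch i)).
Hypothesis ms : forall i k, measurable_fun [set: Z] (y^~ (InService i k)).

Lemma measurable_arrival i : measurable_fun [set: Z] (fun z => arrival (y z) i).
Proof. by apply: measurable_sum => j; exact: mg. Qed.

Lemma measurable_batch_customers t :
  measurable_fun [set: Z] (fun z => batch_customers (y z) t).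
Proof.
rewrite (_ : (fun _ => _) = (fun z => \sum_(0 <= i <oo | i \in predT)
   (((arrival (y z) i <= t)%R)%:R * (in_service (y z) t i)%:R)%:E)%E); last first.
  apply/funext => z; rewrite /batch_customers eseries_mkcond.
  apply: eq_eseriesr => i _; case: ifP => _; first by rewrite mul1r.
  by rewrite mul0r.
apply: ge0_emeasurable_sum => [i z _ _|i _]; first by rewrite lee_fin mulr_ge0.
apply/measurable_EFinP; apply: measurable_funM.
  by apply/measurable_indicator/measurable_fun_ler => //; exact: measurable_arrival.
apply: (@measurable_count_above _ Z R _ (fun z => t - arrival (y z) i)
  (fun k z => y z (InService i k))) => //.
by apply: measurable_funB => //; exact: measurable_arrival.
Qed.

End measurable_customers.

(** * Moment generating function of the batch customers *)

Section compound_poisson.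
Context d (T : measurableType d) (R : realType) (P : probability T R).
Context (lambda mu : R) (lambda0 : 0 < lambda) (mu0 : 0 < mu).
Context (M : R -> \bar R) (X : queue_input -> T -> R).
Hypothesis HX : batch_inputs P lambda mu M X.
Local Open Scope ereal_scope.

Let mX := inputs_measurable HX.

Lemma gaps_ge0 : {ae P, forall w, forall j, (0 <= X (InGap j) w)%R}.
Proof.
apply: ae_foralln => j.
exists (X (InGap j) @^-1` `]-oo, 0%R[); split.
- by rewrite -[_ @^-1` _]setTI; exact: mX.
- transitivity (exponential_prob lambda `]-oo, 0%R[); first exact: (gap_exponential HX).
  rewrite /exponential_prob integral0_eq// => x/=.
  by rewrite in_itv/= => x0; rewrite lt0_exponential_pdf.
- by move=> w /= /negP; rewrite -ltNge in_itv.
Qed.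

Let measurable_weight_X alpha k t :
  measurable_fun [set: T] (fun w => (weight alpha k t (X^~ w))%:E).
Proof.
apply/measurable_EFinP; exact: (@measurable_weight _ T R alpha k (fun w => X^~ w) (fun=> t)).
Qed.

Let arrival_set k t := [set w | (t < arrival (X^~ w) k)%R].

Let measurable_arrival_set k t : measurable (arrival_set k t).
Proof.
apply: measurable_ltr_set => //.
exact: (@measurable_arrival _ T R (fun w => X^~ w) (fun i => mX (InGap i)) k).
Qed.

(** The terms sum to an exponential series. *)
Lemma integral_weight_series alpha (g G : R -> R) t :
  (forall u, M (ln (thinned mu alpha u)) = (g u)%:E) -> continuous g ->
  (forall x : R, (-1 < x)%R -> is_derive x 1%R G (g x)) -> G 0%R = 0%R ->
  (0 <= t)%R ->
  \int[P]_w (\sum_(0 <= k <oo) (weight alpha k t (X^~ w))%:E) =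
  (expR (- lambda * t + lambda * G t))%:E.
Proof.
move=> gE cg dG G0 t0; rewrite integral_nneseries//; last first.
  by move=> k w _; rewrite lee_fin weight_ge0.
under eq_eseriesr do rewrite (weight_expectation lambda0 mu0 gE cg dG G0 HX _ t0) EFinM.
have Gt0 : (0 <= G t)%R.
  have g0 u : (0 <= g u)%R.
    rewrite -lee_fin -gE -(batch_mgf HX 0).
    by apply: integral_ge0 => w _; rewrite lee_fin expR_ge0.
  have dG' (x : R) : (0 <= x <= t)%R -> is_derive x 1%R G (g x).
    by move=> /andP[x0 _]; apply: dG; lra.
  have := integral_derivative t0 dG' (fun x _ => cg x).
  rewrite G0 subr0 => E; rewrite -lee_fin -E.
  by apply: integral_ge0 => x _; rewrite lee_fin.
rewrite nneseriesZl//; last first.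
  by move=> k _; rewrite lee_fin divr_ge0// exprn_ge0// mulr_ge0// ltW.
rewrite expRD EFinM; congr (_ * _).
rewrite expRE -EFin_lim; last first.
  rewrite /pseries/=; under eq_fun do rewrite mulrC.
  exact: is_cvg_series_exp_coeff.
apply/congr_lim/funext => n/=; rewrite /pseries/= /series/= -sumEFin//.
by under eq_bigr do rewrite mulrC.
Qed.

(** At alpha = 0 every weight is the indicator that exactly [k] batches have
    arrived, and these indicators add up to that of the event in question. The
    sum of their expectations is 1 by the previous lemma. *)
Lemma arrivals_diverge t : (0 <= t)%R ->
  {ae P, forall w, exists k, (t < arrival (X^~ w) k)%R}.
Proof.
move=> t0; pose C := \bigcup_k arrival_set k t.
have mC : measurable C by exact: bigcup_measurable.
have gE u : M (ln (thinned mu 0 u)) = ((cst 1%R) u)%:E.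
  rewrite /thinned expR0 subrr mul0r addr0 ln1 -(batch_mgf HX 0).
  under eq_integral do rewrite mul0r expR0.
  by rewrite integral_cst//= probability_setT mule1.
have dG (x : R) : (-1 < x)%R -> is_derive x 1%R id ((cst 1%R) x : R) by move=> _; exact: is_derive_id.
have := integral_weight_series gE (@cst_continuous _ _ _) dG erefl t0.
rewrite mulNr addNr expR0 => E.
have PC : P C = 1.
  rewrite -[RHS]E -[C in LHS]setIT -integral_indic//.
  apply: ge0_ae_eq_integral => //.
  - by apply/measurable_EFinP; exact: measurable_indic.
  - rewrite (_ : (fun w => _) = (fun w => \sum_(0 <= i <oo | i \in predT)
       (weight 0 i t (X^~ w))%:E))//.
    by apply: ge0_emeasurable_sum => // k w _ _; rewrite lee_fin weight_ge0.
  - by move=> w _; apply: nneseries_ge0 => k _ _; rewrite lee_fin weight_ge0.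
  - apply: filterS gaps_ge0 => w w0 _; rewrite indicE.
    have [[k tk]|nk] := pselect (exists k, (t < arrival (X^~ w) k)%R).
    + rewrite mem_set; last by exists k.
      by rewrite weight_decomposition//; [rewrite mul0r expR0|exists k].
    + rewrite memNset; last by move=> [k _ tk]; apply: nk; exists k.
      by rewrite weight_sum0.
exists (~` C); split; first exact: measurableC.
- by rewrite probability_setC// PC subee.
- by move=> w /= nk [k _ tk]; apply: nk; exists k.
Qed.

Lemma batch_customers_mgf alpha (g G : R -> R) t :
  (forall u, M (ln (thinned mu alpha u)) = (g u)%:E) -> continuous g ->
  (forall x : R, (-1 < x)%R -> is_derive x 1%R G (g x)) -> G 0%R = 0%R ->
  (0 <= t)%R ->
  \int[P]_w (expR (alpha * fine (batch_customers (X^~ w) t)))%:E =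
  (expR (- lambda * t + lambda * G t))%:E.
Proof.
move=> gE cg dG G0 t0; rewrite -(integral_weight_series gE cg dG G0 t0).
apply: ge0_ae_eq_integral => //.
- apply/measurable_EFinP; apply: measurableT_comp => //; apply: measurable_funM => //.
  apply: (measurableT_comp (@fine_measurable R setT measurableT)).
  exact: (@measurable_batch_customers _ T R (fun w => X^~ w)).
- rewrite (_ : (fun w => _) = (fun w => \sum_(0 <= i <oo | i \in predT)
     (weight alpha i t (X^~ w))%:E))//.
  by apply: ge0_emeasurable_sum => // k w _ _; rewrite lee_fin weight_ge0.
- by move=> w _; apply: nneseries_ge0 => k _ _; rewrite lee_fin weight_ge0.
- apply: filterS2 gaps_ge0 (arrivals_diverge t0) => w w0 ex _.
  by rewrite weight_decomposition.
Qed.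

End compound_poisson.

(** * Sequences of order 1/n *)

Section scaled_sequences.
Context {R : realType}.
Implicit Types (x y : R^nat) (a : R).

Lemma scaled_cvg0 x a : n%:R * x n @[n --> \oo] --> a -> x n @[n --> \oo] --> 0.
Proof.
move=> nx.
have h1 : n%:R * x n / n%:R @[n --> \oo] --> (0 : R).
  rewrite -(mulr0 a); apply: cvgM => //.
  by rewrite -(cvg_shiftS _)/=; exact: cvg_harmonic.
apply: cvg_trans h1; apply: near_eq_cvg; near=> n.
by rewrite mulrAC divff ?mul1r// pnatr_eq0 -lt0n; near: n; exists 1%N.
Unshelve. all: by end_near. Qed.

Lemma expRB1_le (r : R) : expR r - 1 <= r * expR r.
Proof.
have := expR_ge1Dx (- r); rewrite expRN => h.
have e0 := expR_gt0 r.
have : (1 - r) * expR r <= 1 by rewrite -ler_pdivlMr// div1r.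
lra.
Qed.

(** Squeeze with r <= exp(r) - 1 <= r exp(r). *)
Lemma scaled_cvg_expR x a : n%:R * x n @[n --> \oo] --> a ->
  n%:R * (expR (x n) - 1) @[n --> \oo] --> a.
Proof.
move=> nx; have x0 := scaled_cvg0 nx.
apply: (squeeze_cvgr _ nx (h := fun n => n%:R * x n * expR (x n))).
- near=> n; apply/andP; split.
  + by rewrite ler_wpM2l// lerBrDl expR_ge1Dx.
  + by rewrite -mulrA ler_wpM2l// expRB1_le.
- rewrite -[X in _ --> X]mulr1; apply: cvgM => //.
  by rewrite -expR0; apply: continuous_cvg => //; exact: continuous_expR.
Unshelve. all: by end_near. Qed.

(** Squeeze with r / (1 + r) <= ln (1 + r) <= r. *)
Lemma scaled_cvg_ln y a : n%:R * y n @[n --> \oo] --> a ->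
  n%:R * ln (1 + y n) @[n --> \oo] --> a.
Proof.
move=> ny; have y0 := scaled_cvg0 ny.
apply: (squeeze_cvgr _ _ ny (f := fun n => n%:R * y n / (1 + y n))).
- have y1 : \forall n \near \oo, -1 < y n.
    by apply: (cvgr_gt 0) => //; rewrite ltrN10.
  near=> n; have yn : -1 < y n by near: n.
  have z0 : 0 < 1 + y n by lra.
  apply/andP; split; last by rewrite ler_wpM2l// le_ln1Dx.
  rewrite -mulrA ler_wpM2l// -lerN2 -lnV ?posrE//.
  have e : (1 + y n)^-1 = 1 + - (y n / (1 + y n)) by field; rewrite gt_eqF.
  rewrite [X in ln X]e.
  apply: le_ln1Dx; rewrite ltrN2 ltr_pdivrMr// mul1r; lra.
- rewrite -[X in _ --> X]divr1; apply: cvgM => //.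
  rewrite -[X in X^-1](addr0 1); apply: cvgV; first by rewrite addr0.
  by apply: cvgD => //; exact: cvg_cst.
Unshelve. all: by end_near. Qed.

Lemma scaled_cvg_expn y a : n%:R * y n @[n --> \oo] --> a ->
  (1 + y n) ^+ n @[n --> \oo] --> expR a.
Proof.
move=> ny; have y0 := scaled_cvg0 ny; have lny := scaled_cvg_ln ny.
have h : expR (n%:R * ln (1 + y n)) @[n --> \oo] --> expR a.
  by apply: continuous_cvg => //; exact: continuous_expR.
apply: cvg_trans h; apply: near_eq_cvg.
have y1 : \forall n \near \oo, -1 < y n.
  by apply: (cvgr_gt 0) => //; rewrite ltrN10.
near=> n; have yn : -1 < y n by near: n.
by rewrite expRM_natl lnK// posrE; lra.
Unshelve. all: by end_near. Qed.

End scaled_sequences.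

Section dominated_near.
Context d (T : measurableType d) (R : realType) (m : {measure set T -> \bar R}).
Context (D : set T) (mD : measurable D).

(** Dominated convergence for a sequence that is measurable and dominated from
    some rank on. *)
Lemma dominated_cvg_near (f : nat -> T -> R) (l g : T -> R) :
  (\forall n \near \oo, measurable_fun D (f n)) -> measurable_fun D l ->
  m.-integrable D (EFin \o g) ->
  (\forall n \near \oo, forall x, D x -> `|f n x| <= g x) ->
  (forall x, D x -> f n x @[n --> \oo] --> l x) ->
  (\int[m]_(x in D) (f n x)%:E @[n --> \oo] --> \int[m]_(x in D) (l x)%:E)%E.
Proof.
move=> [N1 _ mf] ml ig [N2 _ fg] fl; pose N := (N1 + N2)%N; rewrite -(cvg_shiftn N)/=.
apply: (dominated_cvg mD (g := EFin \o g) (f_ := fun n x => (f (n + N)%N x)%:E)) => //.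
- move=> n; apply/measurable_EFinP; apply: mf => /=.
  by rewrite /N addnCA leq_addr.
- move=> x Dx; apply: cvg_EFin; first exact: nearW.
  by have := fl _ Dx; rewrite -(cvg_shiftn N); exact.
- by move=> n x Dx /=; rewrite lee_fin fg//= /N addnA leq_addl.
Qed.

End dominated_near.

(** * Moment generating functions near zero *)

Section mgf_near_zero.
Context d (T : measurableType d) (R : realType) (P : probability T R).
Context (B : T -> R) (delta : R).
Hypothesis mB : measurable_fun [set: T] B.
Hypothesis B0 : forall w, 0 <= B w.
Hypothesis delta0 : 0 <= delta.
Hypothesis iB : P.-integrable [set: T] (fun w => (B w * expR (delta * B w))%:E).

(** The hypothesis on B exp(delta B) serves both signs: delta = 0 only asks for
    a finite mean, and delta > 0 gives room above 0. *)
Definition mgf (b : R) : R := \int[P]_w expR (b * B w).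

Let measurable_expRM b : measurable_fun [set: T] (fun w => expR (b * B w)).
Proof. by apply: measurableT_comp => //; exact: measurable_funM. Qed.

Let integrable_bound (f : T -> R) (c : R) : measurable_fun [set: T] f ->
  (forall w, `|f w| <= c + delta * (B w * expR (delta * B w)) + B w * expR (delta * B w)) ->
  P.-integrable [set: T] (EFin \o f).
Proof.
move=> mf fle.
apply: (@le_integrable _ _ _ P setT _ _
    (fun w => (c + delta * (B w * expR (delta * B w)) + B w * expR (delta * B w))%:E)) => //.
- exact/measurable_EFinP.
- by move=> w _ /=; rewrite lee_fin (le_trans (fle w))// ler_norm.
- under eq_fun do rewrite EFinD EFinD EFinM.
  apply: integrableD => //; apply: integrableD => //.
    exact: finite_measure_integrable_cst.
  exact: integrableZl.
Qed.

Let Be0 w : 0 <= B w * expR (delta * B w).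
Proof. by rewrite mulr_ge0 ?expR_ge0. Qed.

Lemma integrable_mgf b : b <= delta ->
  P.-integrable [set: T] (fun w => (expR (b * B w))%:E).
Proof.
move=> bd; apply: (@integrable_bound _ 1) => // w.
rewrite ger0_norm ?expR_ge0//.
apply: (@le_trans _ _ (expR (delta * B w))); first by rewrite ler_expR ler_wpM2r.
have := expRB1_le (delta * B w); have := Be0 w; rewrite mulrA; lra.
Qed.

Lemma mgfE b : b <= delta -> (\int[P]_w (expR (b * B w))%:E = (mgf b)%:E)%E.
Proof.
by move=> bd; rewrite /mgf /Rintegral fineK// integrable_fin_num// integrable_mgf.
Qed.

Lemma mgf_ge0 b : 0 <= mgf b.
Proof. by apply: Rintegral_ge0 => w _; exact: expR_ge0. Qed.

Lemma mgf_le b b' : b <= b' -> b' <= delta -> mgf b <= mgf b'.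
Proof.
move=> bb' b'd; apply: le_Rintegral => //; [apply: integrable_mgf..|].
- exact: le_trans bb' b'd.
- by [].
- by move=> w _; rewrite ler_expR ler_wpM2r.
Qed.

Lemma mgf_continuous b : b < delta -> {for b, continuous mgf}.
Proof.
move=> bd.
apply: (@continuity_under_integral R d T P (fun b w => expR (b * B w)) setT measurableT
  (b - 1) delta _ _ (fun w => expR (delta * B w))).
- move=> x /=; rewrite in_itv/= => /andP[_ xd]; apply: integrable_mgf; exact: ltW.
- apply: aeW => w _ x _; apply: continuous_comp; last exact: continuous_expR.
  by apply: continuousM => //; exact: cst_continuous.
- exact: integrable_mgf.
- move=> x /=; rewrite in_itv/= => /andP[_ xd]; apply: aeW => w _.
  by rewrite ger0_norm ?expR_ge0// ler_expR ler_wpM2r// ltW.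
- by rewrite inE/= in_itv/= bd andbT gtrBl.
Qed.

(** The derivative at 0 of the moment generating function is the mean. The
    dominating function comes from |exp(x) - 1| <= |x| exp(max x 0). *)
Lemma mgf_scaled (b : R^nat) (a : R) :
  n%:R * b n @[n --> \oo] --> a -> (\forall n \near \oo, b n <= delta) ->
  n%:R * (mgf (b n) - 1) @[n --> \oo] --> a * \int[P]_w B w.
Proof.
move=> nb bd.
have iB1 : P.-integrable [set: T] (EFin \o B).
  apply: (@integrable_bound _ 0) => // w; rewrite ger0_norm// add0r.
  apply: ler_wpDl; first by rewrite mulr_ge0.
  by rewrite ler_peMr// -expR0 ler_expR mulr_ge0.
have key : ((\int[P]_w (n%:R * (expR (b n * B w) - 1))%:E)%E @[n --> \oo] -->
    (\int[P]_w (a * B w)%:E)%E).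
  apply: (@dominated_cvg_near _ T R P setT measurableT
    (fun n w => n%:R * (expR (b n * B w) - 1)) (fun w => a * B w)
    (fun w => (`|a| + 1) * (B w * expR (delta * B w)))).
  - by apply: nearW => n; apply: measurable_funM => //; apply: measurable_funB.
  - exact: measurable_funM.
  - have := integrableZl measurableT (`|a| + 1) iB.
    by apply: eq_integrable => // w _.
  - have nba : \forall n \near \oo, `|n%:R * b n| < `|a| + 1.
      by apply: (cvgr_lt `|a|); [exact: cvg_norm|rewrite ltrDl].
    near=> n => w _; have bn : b n <= delta by near: n.
    rewrite normrM ger0_norm//.
    apply: (@le_trans _ _ (`|n%:R * b n| * (B w * expR (delta * B w)))); last first.
      by rewrite ler_wpM2r//; apply: ltW; near: n.
    rewrite normrM (ger0_norm (ler0n _ n)) -mulrA ler_wpM2l//.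
    have [b0|b0] := leP 0 (b n).
      rewrite (ger0_norm b0) ger0_norm; last first.
        by rewrite subr_ge0 -expR0 ler_expR mulr_ge0.
      rewrite (le_trans (expRB1_le _))// mulrA ler_wpM2l ?mulr_ge0//.
      by rewrite ler_expR ler_wpM2r.
    rewrite (ltr0_norm b0) ler0_norm; last first.
      by rewrite subr_le0 -expR0 ler_expR nmulr_rle0.
    rewrite opprB (@le_trans _ _ (- b n * B w))//.
      by have := expR_ge1Dx (b n * B w); lra.
    apply: ler_wpM2l; first by rewrite oppr_ge0 ltW.
    by rewrite ler_peMr// -expR0 ler_expR mulr_ge0.
  - move=> w _.
    apply: scaled_cvg_expR; under eq_fun do rewrite mulrA.
    by apply: cvgM => //; exact: cvg_cst.
have E : (\int[P]_w (a * B w)%:E)%E = (a * \int[P]_w B w)%:E.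
  under eq_integral do rewrite EFinM.
  rewrite integralZl// EFinM; congr (_ * _)%E.
  by rewrite /Rintegral fineK// integrable_fin_num.
rewrite E in key; move/fine_cvgP : key => -[_ key].
apply: cvg_trans key; apply: near_eq_cvg; near=> n => /=.
have bn : b n <= delta by near: n.
have /= i1 := integrable_mgf bn.
under eq_integral do rewrite EFinM.
rewrite integralZl//; last first.
  under eq_fun do rewrite EFinB.
  by apply: integrableB => //; exact: finite_measure_integrable_cst.
under eq_integral do rewrite EFinB.
rewrite integralB//; last exact: finite_measure_integrable_cst.
by rewrite mgfE// integral_cst//= probability_setT mule1.
Unshelve. all: by end_near. Qed.

Lemma mgf_expn_cvg (b : R^nat) (a : R) :
  n%:R * b n @[n --> \oo] --> a -> (\forall n \near \oo, b n <= delta) ->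
  mgf (b n) ^+ n @[n --> \oo] --> expR (a * \int[P]_w B w).
Proof.
move=> nb bd; have := scaled_cvg_expn (mgf_scaled nb bd).
by under eq_fun do rewrite addrC subrK.
Qed.

End mgf_near_zero.

(** * The limit of the batch generating functions *)

Section thinning_limit.
Context d (T : measurableType d) (R : realType) (P : probability T R).
Context (B : T -> R) (delta mu theta : R).
Hypothesis mB : measurable_fun [set: T] B.
Hypothesis B0 : forall w, 0 <= B w.
Hypothesis delta0 : 0 <= delta.
Hypothesis iB : P.-integrable [set: T] (fun w => (B w * expR (delta * B w))%:E).
Hypothesis theta_sign : theta < 0 \/ 0 < delta.
Notation leb := (@lebesgue_measure R).

Let EB := \int[P]_w B w.

(** The argument at which the generating function of one summand of a batch is
    taken. *)
Definition exponent n u : R := ln (thinned mu (theta / n%:R) u).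
Definition pgf_thinned n u : R := mgf P B (exponent n u) ^+ n.

Let scaled_theta : n%:R * (theta / n%:R) @[n --> \oo] --> theta.
Proof.
apply: cvg_near_cst; near=> n.
rewrite mulrC divfK// pnatr_eq0 -lt0n; near: n; exact: nbhs_infty_gt.
Unshelve. all: by end_near. Qed.

Lemma exponent_scaled u :
  n%:R * exponent n u @[n --> \oo] --> theta * expR (- mu * Num.max u 0).
Proof.
apply: scaled_cvg_ln; under eq_fun do rewrite mulrA.
by apply: cvgM; [exact: scaled_cvg_expR|exact: cvg_cst].
Qed.

Hypothesis mu0 : 0 < mu.

(** A thinned factor is closer to 1 than exp(theta / n), on the same side. *)
Lemma exponent_le n u : exponent n u <= Num.max 0 (theta / n%:R).
Proof.
have /andP[p0 p1] := survival_itv mu0 u.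
have th0 := thinned_gt0 mu0 (theta / n%:R) u.
rewrite -ler_expR /exponent lnK ?posrE// /thinned.
set p := expR _ in p0 p1 *; set a := theta / _.
have [a0|a0] := leP a 0.
  have : expR a <= 1 by rewrite expR_le1.
  by rewrite expR0; nra.
have : 1 <= expR a by rewrite -expR0 ler_expR ltW.
by nra.
Qed.

(** For theta < 0 the exponents are negative, since a customer survives with
    positive probability; for theta > 0 they are at most theta / n. *)
Lemma exponent_lt : \forall n \near \oo, forall u, exponent n u < delta.
Proof.
have n0 : \forall n \near \oo, (0 < n)%N by exact: nbhs_infty_gt.
case: theta_sign => [th0|d0].
  near=> n => u; apply: lt_le_trans delta0.
  have /andP[p0 p1] := survival_itv mu0 u.
  apply: ln_lt0; rewrite thinned_gt0//= /thinned.
  set p := expR _ in p0 p1 *.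
  have : expR (theta / n%:R) < 1.
    by rewrite expR_lt1 pmulr_llt0// invr_gt0 ltr0n; near: n.
  by nra.
have := scaled_cvg0 scaled_theta => h.
have hd : \forall n \near \oo, theta / n%:R < delta by exact: (cvgr_lt 0).
near=> n => u; apply: (le_lt_trans (exponent_le n u)).
by rewrite gt_max d0; near: n.
Unshelve. all: by end_near. Qed.

Lemma exponent_continuous n : continuous (exponent n).
Proof.
move=> u.
have c1 : {for u, continuous (fun u : R => Num.max u 0)}.
  by apply: continuous_max => //; exact: cst_continuous.
have c2 : {for u, continuous (fun u : R => expR (- mu * Num.max u 0))}.
  apply: (@continuous_comp _ _ _ (fun u : R => - mu * Num.max u 0) expR).
    by apply: continuousM; [exact: cst_continuous|exact: c1].
  exact: continuous_expR.
have c3 : {for u, continuous (thinned mu (theta / n%:R))}.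
  apply: continuousD; first exact: cst_continuous.
  by apply: continuousM; [exact: cst_continuous|exact: c2].
by apply: (continuous_comp c3); apply: continuous_ln; exact: thinned_gt0.
Qed.

Lemma pgf_thinned_continuous : \forall n \near \oo, continuous (pgf_thinned n).
Proof.
near=> n; have lt_d : forall u, exponent n u < delta by near: n; exact: exponent_lt.
move=> u.
have c1 : {for u, continuous (fun u => mgf P B (exponent n u))}.
  have c := mgf_continuous mB B0 iB (lt_d u).
  exact: (continuous_comp (@exponent_continuous n u) c).
exact: (continuous_comp c1 (@exprn_continuous R n _)).
Unshelve. all: by end_near. Qed.

(** The exponents are at most max 0 (theta / n), where the powers converge. *)
Lemma pgf_thinned_bounded : \forall n \near \oo, forall u,
  `|pgf_thinned n u| <= expR (Num.max 0 theta * EB) + 1.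
Proof.
pose b n := Num.max 0 (theta / n%:R).
have nb : n%:R * b n @[n --> \oo] --> Num.max 0 theta.
  have h : Num.max 0 (n%:R * (theta / n%:R)) @[n --> \oo] --> Num.max 0 theta.
    have c : {for theta, continuous (fun x : R => Num.max 0 x)}.
      by apply: (@continuous_max R R (fun=> 0) id) => //; exact: cst_continuous.
    exact: (cvg_comp _ _ scaled_theta c).
  by apply: cvg_trans h; apply: near_eq_cvg; near=> n; rewrite /b maxr_pMr ?mulr0.
have bd : \forall n \near \oo, b n <= delta.
  case: theta_sign => [th0|d0].
    apply: nearW => n; rewrite /b ge_max delta0 (le_trans _ delta0)//.
    by rewrite mulr_le0_ge0 ?invr_ge0 ?ler0n// ltW.
  have hd : \forall n \near \oo, theta / n%:R < delta.
    by apply: (cvgr_lt 0) => //; exact: scaled_cvg0 scaled_theta.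
  by near=> n; rewrite /b ge_max delta0/= ltW//; near: n.
have h : \forall n \near \oo, mgf P B (b n) ^+ n < expR (Num.max 0 theta * EB) + 1.
  apply: (cvgr_lt _ (mgf_expn_cvg mB B0 delta0 iB nb bd)).
  by rewrite ltrDl.
near=> n => u; rewrite ger0_norm ?exprn_ge0 ?mgf_ge0//.
have hn : mgf P B (b n) ^+ n < expR (Num.max 0 theta * EB) + 1 by near: n.
apply: le_trans (ltW hn); rewrite lerXn2r ?nnegrE ?mgf_ge0//.
apply: (mgf_le mB B0 iB); first exact: exponent_le.
by near: n.
Unshelve. all: by end_near. Qed.

Lemma integral_pgf_thinned_cvg t :
  (\int[leb]_(u in `[0%R, t]) (pgf_thinned n u)%:E @[n --> \oo] -->
   \int[leb]_(u in `[0%R, t]) (expR (theta * EB * expR (- mu * u)))%:E)%E.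
Proof.
apply: (@dominated_cvg_near _ (measurableTypeR R) R leb `[0%R, t] _ pgf_thinned
  (fun u => expR (theta * EB * expR (- mu * u)))
  (fun=> expR (Num.max 0 theta * EB) + 1)) => //.
- near=> n; apply: measurable_funTS; apply: continuous_measurable_fun.
  by near: n; exact: pgf_thinned_continuous.
- apply: measurable_funTS; apply: measurableT_comp => //.
  by apply: measurable_funM => //; apply: measurableT_comp => //; exact: measurable_funM.
- by apply: continuous_itv_integrable => x _; exact: cst_continuous.
- by apply: filterS pgf_thinned_bounded => n h u _; exact: h.
- move=> u /=; rewrite in_itv/= => /andP[u0 _].
  rewrite -mulrA [EB * _]mulrC mulrA -[X in - mu * X](max_l u0).
  apply: (mgf_expn_cvg mB B0 delta0 iB); first exact: exponent_scaled.
  by apply: filterS exponent_lt => n; move=> /(_ u)/ltW.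
Unshelve. all: by end_near. Qed.

End thinning_limit.

(** * Exponential integrals *)

Section exponential_integral_values.
Context {R : realType}.
Notation leb := (@lebesgue_measure R).

(** At 0 the quotient (exp(x) - 1) / x is extended by the derivative of the
    exponential, in the form given by Caratheodory. *)
Lemma expRB1_quotient : exists r : R -> R, continuous r /\
  (forall x, expR x - 1 = r x * x).
Proof.
have /is_derive1_caratheodory[r [rE r0 r01]] := is_derive_expR (0 : R).
exists r; split; last by move=> x; have := rE x; rewrite expR0 subr0.
move=> x; have [->//|x0] := eqVneq x 0.
have h : (fun y => (expR y - 1) / y) y @[y --> x] --> (expR x - 1) / x.
  apply: cvgM; last exact: cvgV.
  by apply: cvgB; [exact: continuous_expR|exact: cvg_cst].
have e y : y != 0 -> (expR y - 1) / y = r y.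
  by move=> y0; have := rE y; rewrite expR0 subr0 => ->; rewrite mulfK.
have xn : \forall y \near x, y != 0 by exact: (@cvgr_neq0 R R R (nbhs (x : R)) _ id x (@cvg_id _ _) x0).
rewrite /continuous_at -e//; apply: cvg_trans h; apply: near_eq_cvg; near=> y.
by rewrite e//; near: y.
Unshelve. all: by end_near. Qed.

(** L1 and L2 are the logarithm plus a function smooth at 0, so in H = L2 - L1
    the logarithms cancel. *)
Lemma expint_antiderivatives : exists L1 L2 H : R -> R,
  [/\ forall x : R, 0 < x -> is_derive x 1 L1 (expR (- x) / x),
      forall x : R, 0 < x -> is_derive x 1 L2 (expR x / x),
      forall x : R, 0 < x -> H x = L2 x - L1 x,
      {for 0, continuous H} & H 0 = 0].
Proof.
have [r [cr rE]] := expRB1_quotient.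
have [G G0 dG] := antiderivative cr.
have cr' : continuous (fun x => - r (- x)).
  by move=> x; apply: continuousN; apply: continuous_comp; [exact: continuousN|exact: cr].
have [K K0 dK] := antiderivative cr'.
have dx (x : R) : 0 < x -> -1 < x by move=> x0; lra.
have c0 (F : R -> R) f : (forall x : R, -1 < x -> is_derive x 1 F (f x)) -> {for 0, continuous F}.
  move=> dF; apply: differentiable_continuous; apply/derivable1_diffP.
  by have [] := dF 0 _ => //; rewrite ltrN10.
exists (@ln R + K), (@ln R + G), (G - K); split.
- move=> x x0; have dKx := dK x (dx x x0); have dlnx := is_derive1_ln x0.
  apply: (is_derive_eq (is_deriveD dlnx dKx)).
  have := rE (- x); rewrite mulrN => /eqP; rewrite subr_eq => /eqP ->.
  by field; rewrite gt_eqF.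
- move=> x x0; have dGx := dG x (dx x x0); have dlnx := is_derive1_ln x0.
  apply: (is_derive_eq (is_deriveD dlnx dGx)).
  have := rE x => /eqP; rewrite subr_eq => /eqP ->.
  by field; rewrite gt_eqF.
- by move=> x x0; rewrite !fctE; ring.
- by apply: continuousB; [exact: c0 dG|exact: c0 dK].
- by rewrite !fctE G0 K0 subrr.
Qed.

Let p (s : R) := expR (- s) / s.

Let cp (s : R) : s != 0 -> {for s, continuous p}.
Proof.
move=> s0; apply: continuousM; last exact: continuousV.
apply: continuous_comp; [exact: continuousN|exact: continuous_expR].
Qed.

Let integrable_p (x : R) : 0 < x -> leb.-integrable `[x, +oo[ (EFin \o p).
Proof.
move=> x0.
have ie : leb.-integrable `[x, +oo[ (fun s => (expR (- s) / x)%:E).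
  have mf (D : set R) : measurable_fun D (fun s : R => (expR (- s) / x)%:E).
    apply: measurable_funTS; apply/measurable_EFinP; apply: measurable_funM => //.
    by apply: measurableT_comp => //; exact: measurable_oppr.
  apply/integrableP; split; first exact: mf.
  under eq_integral do rewrite gee0_abs ?lee_fin ?divr_ge0 ?expR_ge0 ?ltW//.
  have cF (s : R) : is_derive s 1 (fun s => - (expR (- s) / x)) (expR (- s) / x).
    have h := is_derive1_comp (is_derive_expR (- s)) (is_deriveN (is_derive_id s 1)).
    apply: (is_derive_eq (is_deriveN (is_deriveM h (is_derive_cst x^-1 s 1)))).
    by rewrite scaler0 add0r /GRing.scale/= mulrN1 mulrN opprK mulrC.
  have cf : continuous (fun s : R => expR (- s) / x).
    move=> s; have c1 : {for s, continuous (fun s : R => expR (- s))}.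
      by apply: continuous_comp; [exact: continuousN|exact: continuous_expR].
    have c2 : {for s, continuous (fun _ : R => x^-1)} by exact: cst_continuous.
    exact: (continuousM c1 c2).
  rewrite (@ge0_continuous_FTC2y _ _ (fun s => - (expR (- s) / x)) x 0).
  - by rewrite -EFinB ltry.
  - by move=> s _; rewrite divr_ge0 ?expR_ge0// ltW.
  - exact: (continuous_subspaceT cf).
  - rewrite -oppr0; apply: cvgN; rewrite -(mul0r x^-1); apply: cvgM; last exact: cvg_cst.
    exact: cvgr_expR.
  - by move=> s _; have [] := cF s.
  - by apply: cvg_at_right_filter; apply: cvgN; exact: cf.
  - by move=> s _; rewrite derive1E; have dFs := cF s; apply: derive_val.
apply: (le_integrable _ _ _ ie) => //=.
- apply/measurable_EFinP; apply: subspace_continuous_measurable_fun => //.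
  apply: continuous_in_subspaceT => s /[!inE]/=; rewrite in_itv/= andbT => xs.
  by apply: cp; rewrite gt_eqF// (lt_le_trans x0).
- move=> s /=; rewrite in_itv/= andbT => xs; have s0 := lt_le_trans x0 xs.
  rewrite lee_fin !ger0_norm ?divr_ge0 ?expR_ge0 ?(ltW x0) ?(ltW s0)//.
  by rewrite ler_wpM2l ?expR_ge0// lef_pV2.
Qed.

Let Rintegral_derivative (F f : R -> R) (a b : R) : a <= b ->
  (forall x, a <= x <= b -> is_derive x 1 F (f x)) ->
  (forall x, a <= x <= b -> {for x, continuous f}) ->
  \int[leb]_(x in `[a, b]) f x = F b - F a.
Proof. by move=> ab dF cf; rewrite /Rintegral (integral_derivative ab dF cf). Qed.

Section values.
Variables (L1 L2 H : R -> R).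
Hypothesis dL1 : forall x : R, 0 < x -> is_derive x 1 L1 (expR (- x) / x).
Hypothesis dL2 : forall x : R, 0 < x -> is_derive x 1 L2 (expR x / x).
Hypothesis HE : forall x : R, 0 < x -> H x = L2 x - L1 x.
Hypothesis cH : {for 0, continuous H}.
Hypothesis H0 : H 0 = 0.

Let int_pos b a : 0 < b -> b <= a -> \int[leb]_(s in `[b, a]) p s = L1 a - L1 b.
Proof.
move=> b0 ba; apply: Rintegral_derivative => // x /andP[bx _].
  by apply: dL1; exact: lt_le_trans bx.
by apply: cp; rewrite gt_eqF// (lt_le_trans b0).
Qed.

(* On the negative half-line s |-> L2 (- s) has derivative exp(-s) / s. *)
Let int_neg b a : 0 < b -> b <= a -> \int[leb]_(s in `[- a, - b]) p s = L2 b - L2 a.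
Proof.
move=> b0 ba.
have dF x : - a <= x <= - b -> is_derive x 1 (L2 \o -%R) (p x).
  move=> /andP[_ xb]; have x0 : 0 < - x by rewrite (lt_le_trans b0)// lerNr.
  apply: (is_derive_eq (is_derive1_comp (dL2 x0) (is_deriveN (is_derive_id x 1)))).
  by rewrite mulrN1 invrN mulrN opprK.
have cF x : - a <= x <= - b -> {for x, continuous p}.
  by move=> /andP[_ xb]; apply: cp; rewrite lt_eqF// (le_lt_trans xb)// oppr_lt0.
have ab : - a <= - b by rewrite lerN2.
by rewrite (Rintegral_derivative ab dF cF)/= !opprK.
Qed.

Let tail x := \int[leb]_(s in `[x, +oo[) p s.

Let tailE b a : 0 < b -> b <= a -> tail b - tail a = L1 a - L1 b.
Proof.
move=> b0 ba; have a0 := lt_le_trans b0 ba.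
rewrite -(int_pos b0 ba) /tail.
have := Rintegral_itvB (x := a) (integrable_p b0).
rewrite !bnd_simp ba => /(_ isT isT).
rewrite Rintegral_itv_obnd_cbnd; first lra.
by apply: integrableS (integrable_p a0) => //; apply: subset_itvr; rewrite bnd_simp.
Qed.

Lemma expint1B b a : 0 < b -> b <= a -> expint1 b - expint1 a = L1 a - L1 b.
Proof. exact: tailE. Qed.

(** The truncated integral at e is - (H x - tail x) + H e, and H e tends to
    H 0 = 0: this is the existence of the principal value. *)
Lemma expintEiE x : 0 < x -> expintEi x = H x - tail x.
Proof.
move=> x0; rewrite /expintEi -[RHS]opprK; congr (- _).
apply: cvg_lim => //.
have h : (fun e => H e - (H x - tail x)) e @[e --> 0^'+] --> (0 - (H x - tail x)).
  apply: cvgB; last exact: cvg_cst.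
  by rewrite -[X in _ --> X]H0; exact: cvg_at_right_filter cH.
rewrite sub0r in h; apply: cvg_trans h; apply: near_eq_cvg; near=> e.
have e0 : 0 < e by [].
have ex : e <= x by near: e; exact: nbhs_right_le.
have ineg : leb.-integrable `[- x, - e] (EFin \o p).
  apply: continuous_itv_integrable => s /andP[_ se]; apply: cp.
  by rewrite lt_eqF// (le_lt_trans se)// oppr_lt0.
rewrite HE// -(subrK (tail x) (\int[leb]_(s in `]e, +oo[) p s)).
have -> : \int[leb]_(s in `]e, +oo[) p s = tail e.
  rewrite Rintegral_itv_obnd_cbnd//.
  by apply: integrableS (integrable_p e0) => //; apply: subset_itvr; rewrite bnd_simp.
rewrite (tailE e0 ex).
rewrite Rintegral_itv_obnd_cbnd; last first.
  by apply: integrableS ineg => //; apply: subset_itvW.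
rewrite Rintegral_itv_bndo_bndc; last first.
  by apply: integrableS ineg => //; apply: subset_itvl; rewrite bnd_simp.
by rewrite (int_neg e0 ex) HE//; ring.
Unshelve. all: by end_near. Qed.

Lemma expintEiB b a : 0 < b -> b <= a -> expintEi a - expintEi b = L2 a - L2 b.
Proof.
move=> b0 ba; have a0 := lt_le_trans b0 ba.
have := tailE b0 ba; rewrite !expintEiE// !HE//; lra.
Qed.

End values.

Section exponential_decay.
Variables (mu c t : R).
Hypothesis mu0 : 0 < mu.
Hypothesis c0 : 0 < c.
Hypothesis t0 : 0 <= t.

Let y u := c * expR (- mu * u).

Let y0 u : 0 < y u.
Proof. by rewrite mulr_gt0// expR_gt0. Qed.

Let yt : y t <= c.
Proof.
rewrite /y ler_piMr; [by []|exact: ltW|].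
by rewrite -expR0 ler_expR mulNr oppr_le0 mulr_ge0// ltW.
Qed.

Let dy (u : R) : is_derive u 1 y (- mu * y u).
Proof.
have h : is_derive u 1 (fun u : R => - mu * u) (- mu).
  apply: (is_derive_eq (is_deriveZ (- mu) (is_derive_id u 1))).
  by rewrite /GRing.scale/= mulr1.
have h2 := is_derive1_comp (is_derive_expR (- mu * u)) h.
apply: (is_derive_eq (is_deriveZ c h2)).
by rewrite /GRing.scale/= /y; ring.
Qed.

Let cy : continuous y.
Proof.
move=> u; apply: differentiable_continuous; apply/derivable1_diffP.
by have [] := dy u.
Qed.

(* As y' = - mu y, the function - L(y) / mu has derivative h(y). *)
Let integral_decay (h L : R -> R) : continuous h ->
  (forall x : R, 0 < x -> is_derive x 1 L (h x / x)) ->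
  (\int[leb]_(u in `[0%R, t]) (h (y u))%:E)%E = (mu^-1 * (L c - L (y t)))%:E.
Proof.
move=> ch dL.
have dF (u : R) : 0 <= u <= t -> is_derive u 1 (- mu^-1 \*: (L \o y)) (h (y u)).
  move=> _; have d1 := is_derive1_comp (dL _ (y0 u)) (dy u).
  apply: (is_derive_eq (is_deriveZ (- mu^-1) d1)).
  have := y0 u; rewrite /GRing.scale/=; move: (y u) => z z0.
  by field; rewrite !gt_eqF.
have cF (u : R) : 0 <= u <= t -> {for u, continuous (fun u => h (y u))}.
  by move=> _; exact: (continuous_comp (@cy u) (ch _)).
rewrite (integral_derivative t0 dF cF); congr EFin.
rewrite /= /GRing.scale/= {2}/y mulr0 expR0 mulr1; ring.
Qed.

Lemma integral_expR_decay :
  (\int[leb]_(u in `[0%R, t]) (expR (c * expR (- mu * u)))%:E)%E =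
  (mu^-1 * (expintEi c - expintEi (c * expR (- mu * t))))%:E.
Proof.
have [L1 [L2 [H [d1 d2 HE cH H0]]]] := expint_antiderivatives.
rewrite (expintEiB d1 d2 HE cH H0 (y0 t) yt).
exact: integral_decay (@continuous_expR R) d2.
Qed.

Lemma integral_expRN_decay :
  (\int[leb]_(u in `[0%R, t]) (expR (- (c * expR (- mu * u))))%:E)%E =
  (mu^-1 * (expint1 (c * expR (- mu * t)) - expint1 c))%:E.
Proof.
have [L1 [L2 [H [d1 d2 HE cH H0]]]] := expint_antiderivatives.
rewrite (expint1B d1 (y0 t) yt).
apply: (@integral_decay (fun x => expR (- x))) d1.
by move=> x; apply: continuous_comp; [exact: continuousN|exact: continuous_expR].
Qed.

End exponential_decay.

End exponential_integral_values.

(** * The queue as a family of inputs *)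

Section queue_inputs.
Context d (T : measurableType d) (R : realType) (P : probability T R).
Context (lambda mu : R) (q : batch_queue P lambda mu).

Definition inputs (s : queue_input) : T -> R :=
  match s with
  | InInitial => fun w => (initial q w)%:R
  | InResidual j => fun w => residual q j w
  | InGap i => fun w => gap q i w
  | InBatch i => fun w => (batch q i w)%:R
  | InService i k => fun w => service q i k w
  end.

Lemma measurable_natr (N : {mfun T >-> nat}) :
  measurable_fun [set: T] (fun w => (N w)%:R : R).
Proof.
have h : measurable_fun [set: nat] (fun n : nat => n%:R : R) by [].
exact: (measurableT_comp h (measurable_funP N)).
Qed.

Lemma batch_inputs_inputs (M : R -> \bar R) :
  (forall i b, \int[P]_w (expR (b * (batch q i w)%:R))%:E = M b)%E ->
  batch_inputs P lambda mu M inputs.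
Proof.
move=> HM; split.
- case=> [|j|i|i|i k] /=; try exact: measurable_natr; exact: measurable_funP.
- exact: inputs_independent q.
- exact: gap_law q.
- exact: service_law q.
- by move=> i w /=; rewrite natrK.
- exact: HM.
Qed.

Lemma initial_presentE t w : initial_present q t w =
  count_above (inputs InInitial w) (fun j => inputs (InResidual j) w) t.
Proof. by rewrite /count_above/= natrK. Qed.

Lemma number_in_systemE t w : number_in_system q t w =
  (initial_present q t w)%:R + fine (batch_customers (inputs^~ w) t).
Proof.
rewrite /number_in_system /batch_customers; congr (_ + fine _).
apply: eq_eseriesr => i _; congr (_%:R%:E).
rewrite /in_service /count_above /batch_present /= natrK.
by apply: eq_bigr => k _; rewrite ltrBlDl.
Qed.

Lemma measurable_initial_present t :
  measurable_fun [set: T] (fun w => (initial_present q t w)%:R : R).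
Proof.
under eq_fun do rewrite initial_presentE.
apply: (@measurable_count_above _ T R _ (fun=> t) (fun k => inputs (InResidual k))) => //.
exact: measurable_natr.
Qed.

(** The customers present at time 0 use the initial number and the residual
    services, the others use the complementary block. *)
Lemma number_in_system_mgf (M : R -> \bar R) (lambda0 : 0 < lambda) (mu0 : 0 < mu)
    (alpha : R) (g : R -> R) t :
  (forall i b, \int[P]_w (expR (b * (batch q i w)%:R))%:E = M b)%E ->
  (forall u, M (ln (thinned mu alpha u)) = (g u)%:E) -> continuous g -> 0 <= t ->
  'M_P (number_in_system q t) alpha =
  (\int[P]_w (expR (alpha * (initial_present q t w)%:R))%:E *
   (expR (- lambda * t + lambda * \int[lebesgue_measure]_(u in `[0%R, t]) g u))%:E)%E.
Proof.
move=> HM gE cg t0; have HX := batch_inputs_inputs HM.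
have mX := inputs_measurable HX; have iX := inputs_indep HX.
have [G G0 dG] := antiderivative cg.
have -> : \int[lebesgue_measure]_(u in `[0%R, t]) g u = G t.
  have dG' (x : R) : 0 <= x <= t -> is_derive x 1 G (g x).
    by move=> /andP[x0 _]; apply: dG; lra.
  by rewrite /Rintegral (integral_derivative t0 dG' (fun x _ => cg x)) G0 subr0.
rewrite -(batch_customers_mgf lambda0 mu0 HX gE cg dG G0 t0).
rewrite /mmt_gen_fun unlock.
transitivity (\int[P]_w ((expR (alpha * (initial_present q t w)%:R))%:E *
   (expR (alpha * fine (batch_customers (inputs^~ w) t)))%:E))%E.
  apply: eq_integral => w _ /=; rewrite -EFinM -expRD -mulrDr mulrC.
  by rewrite number_in_systemE.
pose K1 := [set s | s = InInitial \/ exists j, s = InResidual j].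
pose K2 := ~` K1.
have nK1 s : (s <> InInitial) -> (forall j, s <> InResidual j) -> K2 s.
  by move=> h1 h2 [|[j]]; [exact: h1|exact: h2].
apply: (@indep_integralM _ T R P _ inputs mX iX K1 K2).
- exact: setICr.
- apply/measurable_EFinP; apply: measurableT_comp => //; apply: measurable_funM => //.
  under eq_fun do rewrite initial_presentE.
  apply: (@measurable_count_above _ (sigma_on inputs K1) R _ (fun=> t)
    (fun k => inputs (InResidual k))) => //.
  + by apply: measurable_input; left.
  + by move=> k; apply: measurable_input; right; exists k.
- apply/measurable_EFinP; apply: measurableT_comp => //; apply: measurable_funM => //.
  apply: (measurableT_comp (@fine_measurable R setT measurableT)).
  apply: (@measurable_batch_customers _ (sigma_on inputs K2) R (fun w => inputs^~ w)).
  + by move=> i; apply: measurable_input; exact: nK1.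
  + by move=> i; apply: measurable_input; exact: nK1.
  + by move=> i k; apply: measurable_input; exact: nK1.
- by move=> w; rewrite lee_fin expR_ge0.
- by move=> w; rewrite lee_fin expR_ge0.
Qed.

End queue_inputs.

Section batch_sum.
Context d (T : measurableType d) (R : realType) (P : probability T R).

Lemma same_law_integral (X Y : {RV P >-> nat}) (f : nat -> R) :
  same_law X Y -> (forall n, 0 <= f n) ->
  (\int[P]_w (f (X w))%:E = \int[P]_w (f (Y w))%:E)%E.
Proof.
move=> XY f0.
have E (Z : {RV P >-> nat}) :
    (\int[P]_w (f (Z w))%:E = \int[distribution P Z]_n (f n)%:E)%E.
  by rewrite ge0_integral_distribution// => n; rewrite lee_fin.
rewrite !E; apply: eq_measure_integral => A mA _; exact: XY.
Qed.

Lemma batch_sum_mgf (N B1 : {RV P >-> nat}) (B : nat -> {RV P >-> nat}) n b :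
  mutually_independent P (fun k w => (B k w)%:R : R) ->
  (forall k, same_law (B k) B1) -> (forall w, N w = (\sum_(k < n) B k w)%N) ->
  (\int[P]_w (expR (b * (N w)%:R))%:E =
   \prod_(k <- index_iota 0 n) \int[P]_w (expR (b * (B1 w)%:R))%:E)%E.
Proof.
move=> iB lB NE.
have mBk k : measurable_fun [set: T] (fun w => (B k w)%:R : R) by exact: measurable_natr.
transitivity (\int[P]_w (\prod_(k <- index_iota 0 n) expR (b * (B k w)%:R))%:E)%E.
  apply: eq_integral => w _; rewrite -expR_sum; congr (expR _)%:E.
  by rewrite -mulr_sumr NE natr_sum big_mkord.
rewrite (indep_integral_prod mBk iB (h := fun _ x => expR (b * x))) ?iota_uniq//.
- apply: eq_bigr => k _.
  by rewrite (same_law_integral (f := fun m => expR (b * m%:R)) (lB k)).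
- by move=> _; apply: measurableT_comp => //; exact: measurable_funM.
Qed.

End batch_sum.

(** * The batch scaling *)

(** Half of the exponent absorbs the factor: r <= exp(r) with r = e X / 2. *)
Lemma mgf_lty_integrable d (T : measurableType d) (R : realType)
    (P : probability T R) (X : T -> R) (e : R) :
  measurable_fun [set: T] X -> (forall w, 0 <= X w) -> 0 < e ->
  ('M_P X e < +oo)%E ->
  P.-integrable [set: T] (fun w => (X w * expR (e / 2 * X w))%:E).
Proof.
move=> mX X0 e0 he.
have mexp c : measurable_fun [set: T] (fun w => expR (c * X w)).
  by apply: measurableT_comp => //; exact: measurable_funM.
have ie : P.-integrable [set: T] (fun w => (expR (e * X w))%:E).
  apply/integrableP; split; first exact/measurable_EFinP.
  apply: le_lt_trans he; rewrite /mmt_gen_fun unlock le_eqVlt; apply/orP; left.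
  by apply/eqP/eq_integral => w _ /=; rewrite ger0_norm ?expR_ge0// mulrC.
have e20 : 0 < e / 2 by rewrite divr_gt0.
apply: (le_integrable _ _ _ (integrableZl measurableT (e / 2)^-1 ie)) => //=.
  by apply/measurable_EFinP; exact: measurable_funM.
move=> w _; rewrite lee_fin !ger0_norm ?mulr_ge0 ?expR_ge0 ?invr_ge0 ?(ltW e20)//.
have -> : e * X w = e / 2 * X w + e / 2 * X w by field.
rewrite expRD mulrA ler_wpM2r ?expR_ge0// ler_pdivlMl//.
by rewrite (le_trans _ (expR_ge1Dx _))// lerDr.
Qed.

Section initial_customers.
Context d (T : measurableType d) (R : realType) (P : probability T R).
Context (lambda mu : R) (Q : nat -> batch_queue P lambda mu) (Q0 : {RV P >-> nat}).

Lemma initial_present_le (q : batch_queue P lambda mu) t w :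
  (initial_present q t w <= initial q w)%N.
Proof.
rewrite /initial_present -[leqRHS]card_ord -sum1_card.
by apply: leq_sum => j _; exact: leq_b1.
Qed.

(** The exponent is at most |theta| / n times [Q0]. For theta > 0 the dominating
    function is exp(e Q0), as soon as theta / n < e. *)
Lemma initial_present_mgf_cvg theta t :
  (forall n, (0 < n)%N -> initial (Q n) = Q0) ->
  (0 < theta -> exists2 e : R, 0 < e & ('M_P (fun w => (Q0 w)%:R) e < +oo)%E) ->
  (\int[P]_w (expR (theta / n%:R * (initial_present (Q n) t w)%:R))%:E
     @[n --> \oo] --> 1)%E.
Proof.
move=> hQ0 mgfQ0.
have n0 : \forall n \near \oo, (0 < n)%N by exact: nbhs_infty_gt.
have th0 : theta / n%:R @[n --> \oo] --> 0.
  apply: (scaled_cvg0 (a := theta)); apply: cvg_near_cst; near=> n.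
  by rewrite mulrC divfK// pnatr_eq0 -lt0n; near: n.
have le0 n w : (0 < n)%N -> (initial_present (Q n) t w)%:R <= (Q0 w)%:R :> R.
  by move=> n0'; rewrite ler_nat -(hQ0 n n0') initial_present_le.
have [g ig gle] : exists2 g : T -> R, P.-integrable [set: T] (EFin \o g) &
    \forall n \near \oo, forall w, expR (theta / n%:R * (initial_present (Q n) t w)%:R) <= g w.
  have [tp|tn] := ltP 0 theta; last first.
    exists (fun=> 1); first exact: finite_measure_integrable_cst.
    near=> n => w; rewrite -expR0 ler_expR mulr_le0_ge0//.
    by rewrite mulr_le0_ge0// invr_ge0.
  have [e e0 he] := mgfQ0 tp.
  exists (fun w => expR (e * (Q0 w)%:R)).
    apply/integrableP; split.
      apply/measurable_EFinP; apply: measurableT_comp => //.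
      by apply: measurable_funM => //; exact: measurable_natr.
    apply: le_lt_trans he; rewrite /mmt_gen_fun unlock le_eqVlt; apply/orP; left; apply/eqP.
    by apply: eq_integral => w _ /=; rewrite ger0_norm ?expR_ge0// mulrC.
  have the : \forall n \near \oo, theta / n%:R < e by exact: (cvgr_lt 0).
  near=> n => w; rewrite ler_expR ler_pM//.
  - by rewrite divr_ge0// ltW.
  - by apply: ltW; near: n.
  - by apply: le0; near: n.
have -> : 1%E = (\int[P]_w (1%R)%:E)%E.
  by rewrite integral_cst//= probability_setT mule1.
apply: (@dominated_cvg_near _ T R P setT measurableT
  (fun n w => expR (theta / n%:R * (initial_present (Q n) t w)%:R)) (fun=> 1) g) => //.
- apply: nearW => n; apply: measurableT_comp => //; apply: measurable_funM => //.
  exact: measurable_initial_present.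
- by apply: filterS gle => n h w _; rewrite ger0_norm ?expR_ge0.
- move=> w _.
  have h : theta / n%:R * (initial_present (Q n) t w)%:R @[n --> \oo] --> 0.
    apply/norm_cvg0P.
    have h0 : `|theta / n%:R| * (Q0 w)%:R @[n --> \oo] --> 0.
      by rewrite -(mul0r (Q0 w)%:R); apply: cvgM; [apply/norm_cvg0P|exact: cvg_cst].
    apply: (squeeze_cvgr _ (cvg_cst 0) h0); near=> n.
    rewrite normr_ge0/= normrM ler_wpM2l// ger0_norm//.
    by apply: le0; near: n.
  by rewrite -[X in _ --> X]expR0; apply: continuous_cvg => //; exact: continuous_expR.
Unshelve. all: by end_near. Qed.

End initial_customers.

Section batch_scaled_limit.
Context (d : measure_display) (T : measurableType d) (R : realType).
Context (P : probability T R) (lambda mu : R) (lambda0 : 0 < lambda) (mu0 : 0 < mu).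
Context (Q : nat -> batch_queue P lambda mu) (Q0 B1 : {RV P >-> nat}).
Hypothesis hQ0 : forall n, (0 < n)%N -> initial (Q n) = Q0.
Hypothesis hN : forall n i, (0 < n)%N -> exists B : nat -> {RV P >-> nat},
    [/\ mutually_independent P (fun k w => (B k w)%:R : R),
        forall k, same_law (B k) B1 &
        forall w, batch (Q n) i w = (\sum_(k < n) B k w)%N].
Context (theta delta t : R).
Hypothesis mgfQ0 : 0 < theta -> exists2 e : R, 0 < e &
    ('M_P (fun w => (Q0 w)%:R) e < +oo)%E.
Hypothesis delta0 : 0 <= delta.
Hypothesis iB : P.-integrable [set: T]
  (fun w => ((B1 w)%:R * expR (delta * (B1 w)%:R))%:E).
Hypothesis theta_sign : theta < 0 \/ 0 < delta.
Hypothesis t0 : 0 <= t.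

Let B w : R := (B1 w)%:R.
Let EB := \int[P]_w B w.

(** For theta < 0 all the exponents at which the moment generating function of B
    is evaluated are at most 0, so delta = 0 will do, that is E[B] finite. For
    theta > 0 they are positive but tend to 0, so any delta > 0 bounds them. *)
Lemma batch_scaled_mgf_cvg (Gamma : R) :
  (\int[lebesgue_measure]_(u in `[0%R, t])
     (expR (theta * EB * expR (- mu * u)))%:E)%E = Gamma%:E ->
  'M_P (number_in_system (Q n) t) (theta / n%:R) @[n --> \oo] -->
  (expR (- lambda * t + lambda * Gamma))%:E.
Proof.
move=> GE.
have mB : measurable_fun [set: T] B by exact: measurable_natr.
have B0 w : 0 <= B w by exact: ler0n.
have n0 : \forall n \near \oo, (0 < n)%N by exact: nbhs_infty_gt.
pose g := pgf_thinned P B mu theta.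
have key : (\int[P]_w (expR (theta / n%:R * (initial_present (Q n) t w)%:R))%:E *
    (expR (- lambda * t + lambda * \int[lebesgue_measure]_(u in `[0%R, t]) g n u))%:E)%E
    @[n --> \oo] --> (expR (- lambda * t + lambda * Gamma))%:E.
  rewrite -[X in _ --> X]mul1e; apply: cvgeM.
  - by rewrite mule_def_fin.
  - exact: initial_present_mgf_cvg hQ0 mgfQ0.
  - apply: cvg_EFin; first exact: nearW.
    apply: continuous_cvg; first exact: continuous_expR.
    apply: cvgD; first exact: cvg_cst.
    apply: cvgM; first exact: cvg_cst.
    apply: fine_cvg; rewrite -GE.
    exact: (integral_pgf_thinned_cvg mB B0 delta0 iB theta_sign mu0).
apply: cvg_trans key; apply: near_eq_cvg.
have lt_d := exponent_lt delta0 theta_sign mu0.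
have cg := pgf_thinned_continuous mB B0 delta0 iB theta_sign mu0.
near=> n.
have n_gt0 : (0 < n)%N by near: n.
have lt_n u : exponent mu theta n u < delta by move: u; near: n.
rewrite (@number_in_system_mgf _ _ _ _ _ _ _
  (fun b => \prod_(k <- index_iota 0 n) \int[P]_w (expR (b * (B1 w)%:R))%:E)%E
  lambda0 mu0 _ (g n))//.
- move=> i b; have [Bk [iBk lBk NE]] := hN i n_gt0.
  exact: batch_sum_mgf iBk lBk NE.
- move=> u; rewrite (eq_bigr (fun=> (mgf P B (exponent mu theta n u))%:E)).
    by rewrite prodEFin big_const_seq count_predT size_iota subn0 iter_mulr_1.
  by move=> k _; apply: (mgfE mB B0 iB); apply: ltW; exact: lt_n.
- by near: n.
Unshelve. all: by end_near. Qed.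

End batch_scaled_limit.

Theorem theorem3p5 (d : measure_display) (T : measurableType d) (R : realType)
  (P : probability T R) (lambda mu : R) (lambda0 : 0 < lambda) (mu0 : 0 < mu)
  (Q : nat -> batch_queue P lambda mu)
  (Q0 : {RV P >-> nat}) (B1 : {RV P >-> nat})
  (hQ0 : forall n, (0 < n)%N -> initial (Q n) = Q0)
  (hN : forall n i, (0 < n)%N -> exists B : nat -> {RV P >-> nat},
    [/\ mutually_independent P (fun k w => (B k w)%:R),
        forall k, same_law (B k) B1 &
        forall w, batch (Q n) i w = (\sum_(k < n) B k w)%N])
  (EB_gt0 : (0 < 'E_P[fun w => (B1 w)%:R])%E)
  (EB_fin : ('E_P[fun w => (B1 w)%:R] < +oo)%E)
  (theta : R)
  (mgfQ0 : 0 < theta -> exists2 e : R, 0 < e &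
    ('M_P (fun w => (Q0 w)%:R) e < +oo)%E)
  (mgfB : 0 < theta -> exists2 e : R, 0 < e &
    ('M_P (fun w => (B1 w)%:R) e < +oo)%E)
  (t : R) (t0 : 0 <= t) :
  let EB : R := fine 'E_P[fun w => (B1 w)%:R] in
  (fun n : nat => 'M_P (number_in_system (Q n) t) (theta / n%:R))
    @ \oo -->
  (if 0 < theta then
     expR (lambda / mu *
       (expintEi (theta * EB) - expintEi (theta * EB * expR (- mu * t))
        - mu * t))
   else if theta < 0 then
     expR (lambda / mu *
       (expint1 (- theta * EB * expR (- mu * t)) - expint1 (- theta * EB)
        - mu * t))
   else 1)%:E.
Proof.
move=> EB.
have EBE : EB = \int[P]_w ((B1 w)%:R : R) by rewrite /EB unlock.
have EB0 : 0 < EB by rewrite /EB fine_gt0// EB_gt0 EB_fin.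
have eq_limit (Gamma L : R) : Gamma = mu^-1 * L ->
    expR (- lambda * t + lambda * Gamma) = expR (lambda / mu * (L - mu * t)).
  by move=> ->; congr expR; field; rewrite gt_eqF.
(* The exponent delta of the batch moment is e / 2 or 0, by the sign of theta. *)
have [tp|tn|t00] := ltgtP 0 theta.
- have [e e0 he] := mgfB tp.
  have e20 : 0 < e / 2 by rewrite divr_gt0.
  have iB : P.-integrable [set: T]
      (fun w => ((B1 w)%:R * expR (e / 2 * (B1 w)%:R))%:E).
    by apply: mgf_lty_integrable => //; exact: measurable_natr.
  have c0 : 0 < theta * EB by rewrite mulr_gt0.
  rewrite -(eq_limit _ _ erefl).
  apply: (batch_scaled_mgf_cvg lambda0 mu0 hQ0 hN mgfQ0 (ltW e20) iB) => //.
    by right.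
  by rewrite -EBE; exact: integral_expR_decay.
- have iB : P.-integrable [set: T]
      (fun w => ((B1 w)%:R * expR (0 * (B1 w)%:R))%:E).
    apply/integrableP; split.
      apply/measurable_EFinP; apply: measurable_funM; first exact: measurable_natr.
      apply: measurableT_comp => //; apply: measurable_funM => //.
      exact: measurable_natr.
    apply: le_lt_trans EB_fin; rewrite unlock le_eqVlt; apply/orP; left.
    by apply/eqP/eq_integral => w _; rewrite mul0r expR0 mulr1 gee0_abs.
  have c0 : 0 < - theta * EB by rewrite mulr_gt0// oppr_gt0.
  rewrite -(eq_limit _ _ erefl).
  apply: (batch_scaled_mgf_cvg lambda0 mu0 hQ0 hN mgfQ0 (lexx 0) iB) => //.
    by left.
  rewrite -EBE -integral_expRN_decay//; apply: eq_integral => u _.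
  by rewrite !mulNr opprK.
- apply: cvg_near_cst; apply: nearW => n.
  rewrite -t00 mul0r /mmt_gen_fun unlock.
  under eq_integral do rewrite /= mulr0 expR0.
  by rewrite integral_cst//= probability_setT mule1.
Qed.
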